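(* Let $BQ$ be a finite biquandle and $L$ a virtual link diagram. For every $\mathfrak{g}\in\mathbb{Z}\mathfrak{G}_{BQ}$, the integer $a_{\mathfrak{g}}(L)$ is a virtual link invariant (unchanged under generalized Reidemeister moves).
   Context: A biquandle is a set $BQ$ with binary operations $\ast,\circ$ such that: (1) $x\ast x=x\circ x$; (2) $-\ast x$ and $-\circ x$ are bijections for every $x$, and $S(x,y)=(y\circ x,x\ast y)$ is invertible; (3) $(z\circ y)\circ(x\ast y)=(z\circ x)\circ(y\circ x)$, $(y\circ x)\ast(z\circ x)=(y\ast z)\circ(x\ast z)$, $(x\ast y)\ast(z\circ y)=(x\ast z)\ast(y\ast z)$ for all $x,y,z$. Semiarcs of a virtual link diagram are the pieces from one real crossing to the next (passing through virtual crossings). A $BQ$-coloring assigns an element of $BQ$ to each semiarc so that at each real crossing: if $x$ is the label of the under-strand semiarc lying to the right of the over-strand and $y$ the label of the over-strand semiarc lying to the right of the under-strand (right taken with respect to the strand orientations), then the other under-strand semiarc is labeled $x\ast y$ and the other over-strand semiarc is labeled $y\circ x$. The weight of the crossing under the coloring is the pair $(x,y)$. $\mathfrak{G}_{BQ}$ is the group with generators $(x,y)\in BQ\times BQ$ and relations $(x,x)=1$, $(x,y)=(x\ast z,y\ast z)$, $(y,z)=(y\circ x,z\circ x)$, $(x,z)=(x\ast y,z\circ y)$ for all $x,y,z\in BQ$. The index of a real crossing $c$ is $\sum_f (x_f,y_f)\in\mathbb{Z}\mathfrak{G}_{BQ}$ (group ring), the sum over all $BQ$-colorings $f$ of $L$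 of the weight of $c$. Let $e$ be the identity of $\mathfrak{G}_{BQ}$ and $N$ the number of colorings. For $\mathfrak{g}\neq N e$, $a_{\mathfrak{g}}(L)$ is the sum of the writhes of the real crossings of index $\mathfrak{g}$; $a_{Ne}(L)$ is the sum of the writhes of the crossings of index $Ne$ minus $w(L)$, the sum of the writhes of all real crossings. *)

(* Defs.v *)
From HB Require Import structures.
From mathcomp Require Import all_boot all_order all_algebra.
From Stdlib Require Import ClassicalEpsilon Relation_Operators.

Set Implicit Arguments.
Unset Strict Implicit.
Unset Printing Implicit Defensive.

Import GRing.Theory.

Definition biquandle (BQ : finType) (ast circ : BQ -> BQ -> BQ) : Prop :=
  (forall x, ast x x = circ x x) /\
  (forall x, bijective (fun z => ast z x)) /\
  (forall x, bijective (fun z => circ z x)) /\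
  bijective (fun p : BQ * BQ => (circ p.2 p.1, ast p.1 p.2)) /\
  (forall x y z, circ (circ z y) (ast x y) = circ (circ z x) (circ y x)) /\
  (forall x y z, ast (circ y x) (circ z x) = circ (ast y z) (ast x z)) /\
  (forall x y z, ast (ast x y) (circ z y) = ast (ast x z) (ast y z)).

Section Group.
Variables (BQ : finType) (ast circ : BQ -> BQ -> BQ).

(* a letter is a generator (x,y) with an exponent: true = +1, false = -1 *)
Definition word := seq ((BQ * BQ) * bool).

Inductive grel : word -> word -> Prop :=
| grel_refl w : grel w w
| grel_sym u v : grel u v -> grel v u
| grel_trans u v w : grel u v -> grel v w -> grel u w
| grel_ctx l r u v : grel u v -> grel (l ++ u ++ r) (l ++ v ++ r)
| grel_inv p b : grel [:: (p, b); (p, ~~ b)] [::]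
| grel_id x : grel [:: ((x, x), true)] [::]
| grel_rel1 x y z : grel [:: ((x, y), true)] [:: ((ast x z, ast y z), true)]
| grel_rel2 x y z : grel [:: ((y, z), true)] [:: ((circ y x, circ z x), true)]
| grel_rel3 x y z : grel [:: ((x, z), true)] [:: ((ast x y, circ z y), true)].

Definition GBQ : Type := {P : word -> Prop | exists w, P = grel w}.
Definition gclass (w : word) : GBQ := exist _ (grel w) (ex_intro _ w erefl).
Definition gunit : GBQ := gclass [::].
Definition ggen (p : BQ * BQ) : GBQ := gclass [:: (p, true)].

Definition ZG : Type :=
  {f : GBQ -> int | exists s : list GBQ, forall h, f h <> 0%R -> List.In h s}.

End Group.

Definition pbool (P : Prop) : bool :=
  if excluded_middle_informative P then true else false.

(* Virtual link diagrams as (signed, oriented) Gauss codes             *)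

(* occurrence of a real crossing on a component:
   (label, passes over?, crossing is positive?) *)
Definition occ := (nat * bool * bool)%type.
Definition olabel (o : occ) : nat := o.1.1.
Definition oover (o : occ) : bool := o.1.2.
Definition opos (o : occ) : bool := o.2.

(* one cyclic word per component; an empty word is a crossingless circle *)
Definition diagram := seq (seq occ).

Definition wf_diagram (D : diagram) : Prop :=
  forall l, l \in map olabel (flatten D) ->
  exists s, [/\ count (pred1 (l, true, s)) (flatten D) = 1%N,
                count (pred1 (l, false, s)) (flatten D) = 1%N
              & count (fun o => olabel o == l) (flatten D) = 2%N].

Definition crossings (D : diagram) : seq nat := undup (map olabel (flatten D)).

Definition csign (D : diagram) (l : nat) : bool :=
  opos (nth (0%N, false, false) (flatten D) (find (fun o => olabel o == l) (flatten D))).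

Definition writhe_c (D : diagram) (l : nat) : int := if csign D l then 1%R else (-1)%R.
Definition writhe (D : diagram) : int := (\sum_(l <- crossings D) writhe_c D l)%R.

(* Sign convention: a crossing is positive iff the (over direction, under
   direction) pair is positively oriented, i.e. the usual right-handed
   crossing (over strand SW->NE, under strand SE->NW). *)

Section Coloring.
Variables (BQ : finType) (ast circ : BQ -> BQ -> BQ).

(* A coloring assigns to component i a list of colors; color j is the
   label of the semiarc leaving the j-th occurrence of component i
   (for a crossingless component, its unique semiarc). *)
Definition ccomp (D : diagram) (o : occ) : nat := find (fun c => o \in c) D.
Definition cpos (D : diagram) (o : occ) : nat := index o (nth [::] D (ccomp D o)).

Definition out_col (D : diagram) (cs : seq (seq BQ)) (o : occ) : option BQ :=
  onth (nth [::] cs (ccomp D o)) (cpos D o).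
Definition in_col (D : diagram) (cs : seq (seq BQ)) (o : occ) : option BQ :=
  let n := size (nth [::] D (ccomp D o)) in
  onth (nth [::] cs (ccomp D o)) ((cpos D o + n.-1) %% n).

Definition cross_cols (D : diagram) (cs : seq (seq BQ)) (l : nat)
  : option (BQ * BQ * BQ * BQ) :=
  let s := csign D l in
  let u := (l, false, s) in
  let v := (l, true, s) in
  match in_col D cs u, out_col D cs u, in_col D cs v, out_col D cs v with
  | Some a, Some b, Some c, Some d => Some (a, b, c, d)
  | _, _, _, _ => None
  end.

(* At a positive crossing the under-arc to the right of the over-strand is the
   incoming under-arc and the over-arc to the right of the under-strand is the
   outgoing over-arc; at a negative crossing they are the outgoing under-arc
   and the incoming over-arc respectively. *)
Definition cross_ok (D : diagram) (cs : seq (seq BQ)) (l : nat) : bool :=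
  match cross_cols D cs l with
  | Some (ui, uo, oi, oo) =>
      if csign D l then (uo == ast ui oo) && (oi == circ oo ui)
      else (ui == ast uo oi) && (oo == circ oi uo)
  | None => false
  end.

Definition cweight (D : diagram) (cs : seq (seq BQ)) (l : nat) : option (BQ * BQ) :=
  match cross_cols D cs l with
  | Some (ui, uo, oi, oo) => if csign D l then Some (ui, oo) else Some (uo, oi)
  | None => None
  end.

Fixpoint all_lists (n : nat) : seq (seq BQ) :=
  if n is n'.+1 then [seq x :: s | x <- enum BQ, s <- all_lists n'] else [:: [::]].

Fixpoint all_shaped (sh : seq nat) : seq (seq (seq BQ)) :=
  if sh is n :: sh' then [seq l :: r | l <- all_lists n, r <- all_shaped sh']
  else [:: [::]].

Definition colorings (D : diagram) : seq (seq (seq BQ)) :=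
  [seq cs <- all_shaped [seq maxn (size c) 1 | c <- D]
     | all (cross_ok D cs) (crossings D)].

Definition cindex (D : diagram) (l : nat) : GBQ ast circ -> int :=
  fun h => (\sum_(cs <- colorings D)
              (if cweight D cs l is Some p then
                 (if pbool (ggen ast circ p = h) then 1 else 0) else 0))%R.

Definition Ne (D : diagram) : GBQ ast circ -> int :=
  fun h => if pbool (h = gunit ast circ) then Posz (size (colorings D)) else 0%R.

Definition a_g (g : ZG ast circ) (D : diagram) : int :=
  ((\sum_(l <- crossings D)
      (if pbool (cindex D l = proj1_sig g) then writhe_c D l else 0))
   - (if pbool (proj1_sig g = Ne D) then writhe D else 0))%R.

End Coloring.

(* diagrams with numbered holes *)
Definition ctx := seq (seq (occ + nat)).

Definition fill (C : ctx) (P : nat -> seq occ) : diagram :=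
  [seq flatten [seq match it with inl o => [:: o] | inr k => P k end | it <- c]
  | c <- C].

Definition ctx_labels (C : ctx) : seq nat :=
  map olabel (pmap (fun it : occ + nat => if it is inl o then Some o else None) (flatten C)).
Definition holes (C : ctx) : seq nat :=
  pmap (fun it : occ + nat => if it is inr k then Some k else None) (flatten C).

(* R2 pieces: strand 0 over both, strand 1 under both (same or opposite
   direction), crossings of opposite signs *)
Definition r2_piece (a b : nat) (s same : bool) (k : nat) : seq occ :=
  if k == 0%N then [:: (a, true, s); (b, true, ~~ s)]
  else if same then [:: (a, false, s); (b, false, ~~ s)]
  else [:: (b, false, ~~ s); (a, false, s)].

(* R3 local picture: edges 0,1,2 of a triangle listed counterclockwise;
   vertex j = edge j meets edge j+1 (mod 3); edge k runs (ccw) from vertex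
   k-1 to vertex k. s k = edge k oriented counterclockwise; h k = height of
   edge k (higher passes over); l j = label of vertex j. *)
Definition r3_occ (l h : nat -> nat) (s : nat -> bool) (j k : nat) : occ :=
  let j1 := (j.+1 %% 3)%N in
  let other := if k == j then j1 else j in
  (l j, (h other < h k)%N, (s j == s j1) == (h j1 < h j)%N).

Definition r3_before (l h : nat -> nat) (s : nat -> bool) (k : nat) : seq occ :=
  let ccw := [:: r3_occ l h s ((k + 2) %% 3)%N k; r3_occ l h s k k] in
  if s k then ccw else rev ccw.

Definition r3_after (l h : nat -> nat) (s : nat -> bool) (k : nat) : seq occ :=
  rev (r3_before l h s k).

Inductive vmove : diagram -> diagram -> Prop :=
| vm_relabel (D : diagram) (r : nat -> nat) :
    injective r -> vmove D (map (map (fun o : occ => (r (olabel o), oover o, opos o))) D)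
| vm_rot (D : diagram) (ks : seq nat) :
    size ks = size D -> vmove D [seq rot k.1 k.2 | k <- zip ks D]
| vm_perm (D D' : diagram) : perm_eq D D' -> vmove D D'
| vm_R1 (C : ctx) (l : nat) (b s : bool) :
    holes C = [:: 0%N] -> l \notin ctx_labels C ->
    vmove (fill C (fun _ => [::])) (fill C (fun _ => [:: (l, b, s); (l, ~~ b, s)]))
| vm_R2 (C : ctx) (a b : nat) (s same : bool) :
    perm_eq (holes C) [:: 0%N; 1%N] -> a != b ->
    a \notin ctx_labels C -> b \notin ctx_labels C ->
    vmove (fill C (fun _ => [::])) (fill C (r2_piece a b s same))
| vm_R3 (C : ctx) (l h : nat -> nat) (s : nat -> bool) :
    perm_eq (holes C) [:: 0%N; 1%N; 2%N] ->
    uniq [:: l 0%N; l 1%N; l 2%N] -> uniq [:: h 0%N; h 1%N; h 2%N] ->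
    all (fun j => l j \notin ctx_labels C) [:: 0%N; 1%N; 2%N] ->
    vmove (fill C (r3_before l h s)) (fill C (r3_after l h s)).

Definition virt_equiv : diagram -> diagram -> Prop := clos_refl_sym_trans diagram vmove.

(* Main.v *)
Require Import Defs.
From mathcomp Require Import all_boot all_order all_algebra zify.
From Stdlib Require Import ClassicalEpsilon.
From Stdlib Require Import FunctionalExtensionality PropExtensionality ProofIrrelevance.

Set Implicit Arguments.
Unset Strict Implicit.
Unset Printing Implicit Defensive.

(* Colorings of a diagram are encoded as decorations of its Gauss code: every
   passage through a crossing carries the colors of its incoming and outgoing
   semiarcs, and consecutive passages agree. Cutting a diagram at the holes of a
   context, a coloring becomes a coloring of the context together with fillings
   having prescribed boundary colors. For each Reidemeister move a filling of one
   side extends uniquely to the other side with the same boundary colors, and the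
   weights of the persisting crossings keep their class in the group. Injections of
   colorings in both directions preserving these classes force equality of the
   numbers of colorings and of the indices. The R1 crossing has weight (x, x), so
   index N e, which the writhe correction in a_{Ne} absorbs; the two R2 crossings
   have equal weights and opposite signs, so their contributions cancel. *)

(** Gauss codes do not record virtual crossings, so besides the three real moves only changes of
    presentation occur: labels, base points, order of components. Extending a coloring across a move
    involves existential choices (inverses of the operations and of S), so no bijection of colorings
    is written down: relations that are total and injective are composed with counting, and
    finiteness of the sets of colorings does the rest. Weights persist literally at the crossings
    outside a move. Only R3 moves them within their class, and there the last three relations of the
    group are exactly what is needed, while [(x, x) = 1] answers R1. Each move is moreover shown to
    preserve well-formedness in both directions, because a chain of moves and inverse moves passes
    through intermediate diagrams about which nothing is assumed. *)

Lemma pboolP (P : Prop) : reflect P (pbool P).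
Proof. by rewrite /pbool; case: excluded_middle_informative => h; constructor. Qed.

Lemma pbool_iff (P Q : Prop) : (P <-> Q) -> pbool P = pbool Q.
Proof. by move=> [pq qp]; apply/pboolP/pboolP. Qed.

(** Greedy matching: each element of [s] removes a partner from [s'], and since no partner is shared
    the remaining elements can still be matched. A relation suffices, so partners need not be given
    by a function. *)
Lemma leq_count_rel (S S' : eqType) (R : S -> S' -> Prop) (p : pred S) (p' : pred S')
    (s : seq S) (s' : seq S') :
  uniq s -> uniq s' ->
  (forall x, x \in s -> exists2 x', x' \in s' & R x x') ->
  (forall x y x', x \in s -> y \in s -> x' \in s' -> R x x' -> R y x' -> x = y) ->
  (forall x x', x \in s -> x' \in s' -> R x x' -> p x -> p' x') ->
  count p s <= count p' s'.
Proof.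
elim: s s' => //= x s IH s' /andP[xs us] us' tot inj pp'.
have [x' x's' Rx] := tot x (mem_head _ _).
have := permP (perm_to_rem x's') p' => /= ->.
apply: leq_add.
  case px: (p x) => //.
  by rewrite (pp' x x' (mem_head _ _) x's' Rx px).
apply: IH => //; first exact: rem_uniq.
- move=> y ys; have yxs : y \in x :: s by rewrite inE ys orbT.
  have [y' y's' Ry] := tot y yxs; exists y' => //.
  rewrite mem_rem_uniq // inE y's' andbT; apply: contraNN xs => /eqP eyx.
  by rewrite (inj x y x') ?mem_head //; rewrite -eyx.
- move=> y z z' ys zs /mem_rem z's'; apply: inj => //; rewrite inE ?ys ?zs orbT //.
- move=> y z' ys /mem_rem z's'; apply: pp' => //; by rewrite inE ys orbT.
Qed.

(** Well-formedness by membership instead of counting: this form is visibly stable under permutation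
    and splits along disjoint sets of labels. *)
Definition good (s : seq occ) : Prop :=
  uniq s /\ forall l b e b' e', (l, b, e) \in s -> ((l, b', e') \in s) = (e' == e).

Lemma wf_diagramP (D : diagram) : wf_diagram D <-> good (flatten D).
Proof.
split=> [wfD|[us good_s] l /mapP[[[l' b] e] os /= ->]]; last first.
  have mem c f := good_s l' b e c f os.
  exists e; rewrite !count_uniq_mem // !mem eqxx; split=> //.
  rewrite -size_filter -[2]/(size [:: (l', true, e); (l', false, e)]).
  apply: perm_size; apply: uniq_perm; [exact: filter_uniq | by rewrite /= inE !xpair_eqE andbF |].
  move=> [[m c] f]; rewrite mem_filter !inE !xpair_eqE /olabel /=.
  have [-> |] //= := eqVneq m l'.
  by rewrite mem; case: c; case: (f == e).
have key l b e b' e' : (l, b, e) \in flatten D -> ((l, b', e') \in flatten D) = (e' == e)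
    /\ count_mem (l, b, e) (flatten D) = 1.
  move=> os; have [|s [ct cf c2]] := wfD l; first by apply/mapP; exists (l, b, e).
  have mem c f : (l, c, f) \in flatten D -> f = s.
    move=> om; apply/eqP/negPn/negP => fs.
    (* A passage of sign other than [s] would be a third one carrying the label [l]. *)
    have : count (predU (pred1 (l, c, f)) (predU (pred1 (l, true, s)) (pred1 (l, false, s)))) (flatten D) <= 2.
      rewrite -c2; apply: sub_count => -[[m d] g] /=; rewrite !xpair_eqE /olabel /=.
      by case: (m == l).
    have := count_predUI (pred1 (l, true, s)) (pred1 (l, false, s)) (flatten D).
    rewrite ct cf (@eq_count _ (predI _ _) pred0) ?count_pred0 => [|x /=]; last first.
      by case: eqP => // ->; rewrite !xpair_eqE andbF.
    have := count_predUI (pred1 (l, c, f)) (predU (pred1 (l, true, s)) (pred1 (l, false, s))) (flatten D).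
    rewrite [X in _ + X = _](@eq_count _ _ pred0) ?count_pred0 => [|x /=]; last first.
      by case: eqP => // ->; rewrite !xpair_eqE (negPf fs) !andbF.
    rewrite !addn0 => -> -> /=.
    by move: om; rewrite -has_pred1 has_count; case: (count _ _) => //= n _; rewrite addn2.
  have inb c : (l, c, s) \in flatten D by rewrite -has_pred1 has_count; case: c; rewrite ?ct ?cf.
  have := mem b e os => es; subst e; split.
    by apply/idP/eqP => [/mem|->].
  by case: (b).
split=> [|l b e b' e' os]; last by have [] := key l b e b' e' os.
apply/(count_mem_uniq) => -[[l b] e]; case: (boolP (_ \in _)) => [os|/count_memPn //].
by have [] := key l b e b e os.
Qed.

(** * Colorings as decorations of Gauss codes *)

Section Decorated.
Variable BQ : finType.

Definition dword (T : Type) := seq (T * (BQ * BQ)).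
(** The extra color sits at the base point of the component. On a crossingless circle it is the only
    color; otherwise closedness forces it to be the last outgoing color. *)
Definition cdiag (T : Type) := seq (BQ * dword T).

Fixpoint chain (T : Type) (x : BQ) (E : dword T) (y : BQ) : bool :=
  if E is (_, (a, b)) :: E' then (a == x) && chain b E' y else x == y.

Definition erase (T : Type) (X : cdiag T) : seq (seq T) := [seq unzip1 c.2 | c <- X].
Definition closed (T : Type) (X : cdiag T) : bool := all (fun c => chain c.1 c.2 c.1) X.
Definition arcs (T : Type) (X : cdiag T) : dword T := flatten [seq c.2 | c <- X].
Definition outs (T : Type) (E : dword T) : seq BQ := [seq i.2.2 | i <- E].

Definition colors (T : Type) (c : BQ * dword T) : seq BQ :=
  if c.2 is [::] then [:: c.1] else outs c.2.
Definition to_cs (T : Type) (X : cdiag T) : seq (seq BQ) := [seq colors c | c <- X].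

Lemma chain_cat (T : Type) x (E F : dword T) y :
  chain x (E ++ F) y <-> exists2 z, chain x E z & chain z F y.
Proof.
elim: E x => [|[t [a b]] E IH] x /=; first by split=> [|[z /eqP->]//]; exists x.
split=> [/andP[-> /IH[z]]|[z /andP[-> Ez] Fy]]; first by exists z.
by apply/IH; exists z.
Qed.

Lemma chain_last (T : Type) x (E : dword T) y : chain x E y -> y = last x (outs E).
Proof. by elim: E x => [|[t [a b]] E IH] x /= => [/eqP->//|/andP[_ /IH]]. Qed.

Lemma chain_outs_inj (T : Type) x (E F : dword T) y z :
  chain x E y -> chain x F z -> unzip1 E = unzip1 F -> outs E = outs F -> E = F.
Proof.
elim: E F x => [|[t [a b]] E IH] [|[t' [a' b']] F] x //=.
move=> /andP[/eqP-> cE] /andP[/eqP-> cF] [-> eEF] [ebb eo]; subst b'.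
by rewrite (IH F b).
Qed.

Lemma arcs_erase (T : Type) (X : cdiag T) : unzip1 (arcs X) = flatten (erase X).
Proof. by rewrite /unzip1 /arcs map_flatten -map_comp. Qed.

(** Outgoing colors determine the decoration: every incoming color is the preceding outgoing one,
    and the base color is the last one. *)
Lemma to_cs_inj (T : Type) (X Y : cdiag T) :
  closed X -> closed Y -> erase X = erase Y -> to_cs X = to_cs Y -> X = Y.
Proof.
elim: X Y => [|[x E] X IH] [|[y F] Y] //= /andP[cE cX] /andP[cF cY] [eEF eXY] [ec eXYc].
congr (_ :: _); last exact: IH.
have [lx ly] := (chain_last cE, chain_last cF).
have inj := chain_outs_inj (x := x) cE; move: ec; rewrite /colors /=.
case: E F {cE} lx ly inj cF eEF => [|e E] [|f F] //= lx ly inj cF eEF eo; first by case: eo => ->.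
have exy : x = y by rewrite lx ly; case: eo => -> ->.
by rewrite -exy in cF *; rewrite (inj (f :: F) x).
Qed.

Lemma decorate (T : Type) x (w : seq T) (c : seq BQ) : size c = size w ->
  exists E : dword T, [/\ unzip1 E = w, outs E = c & chain x E (last x c)].
Proof.
elim: w c x => [|t w IH] [|y c] x //=; first by move=> _; exists [::]; rewrite /= eqxx.
move=> [/(IH c y)[E [<- <- cE]]]; exists ((t, (x, y)) :: E); split=> //=; by rewrite eqxx.
Qed.

Lemma shaped_cdiag (T : Type) (D : seq (seq T)) (cs : seq (seq BQ)) :
  (map size cs = [seq maxn (size c) 1 | c <- D] <->
   exists X : cdiag T, [/\ erase X = D, closed X & to_cs X = cs]).
Proof.
split=> [|[X [<- _ <-]]]; last first.
  rewrite /to_cs /erase -!map_comp; apply: eq_map => -[x E] /=.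
  by rewrite /colors; case: E => //= e E; rewrite /outs /unzip1 !size_map (maxn_idPl _).
elim: D cs => [|w D IH] [|c cs] //=; first by exists [::].
move=> [sc /IH[X [<- cX <-]]].
suff [c' [ew ch ec]] : exists c' : BQ * dword T, [/\ unzip1 c'.2 = w, chain c'.1 c'.2 c'.1 & colors c' = c].
  by exists (c' :: X); split=> //=; rewrite ?ew ?ec ?ch.
case: w sc => [|t w] /= sc; case: c sc => [|x c] //.
  by case: c => // _; exists (x, [::]); split=> //=.
(* The base color is taken to be the last outgoing one, so that the chain closes up. *)
move=> sc; have [|E [e1 e2 ch]] := @decorate T (last x c) (t :: w) (x :: c); first by rewrite sc (maxn_idPl _).
exists (last x c, E); split=> //; rewrite /colors /= e2.
by case: (E) e1.
Qed.

Lemma chain_nth (T : Type) x (E : dword T) y i j : i < size E -> chain x E y ->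
  onth (x :: outs E) i = Some (nth j E i).2.1 /\ onth (outs E) i = Some (nth j E i).2.2.
Proof.
elim: E x i => [|[t [a b]] E IH] x [|i] //=; first by move=> _ /andP[/eqP->].
by rewrite ltnS => iE /andP[_ /(IH _ _ iE)].
Qed.

Lemma comp_pos (D : diagram) i j : uniq (flatten D) -> i < size D -> j < size (nth [::] D i) ->
  forall d, let o := nth d (nth [::] D i) j in ccomp D o = i /\ cpos D o = j.
Proof.
move=> uD iD jD d o.
have ec : ccomp D o = i.
  rewrite /ccomp.
  elim: D i uD iD jD @o => [|w D IH] [|i] //=; rewrite cat_uniq => /and3P[uw dis uD].
    by move=> _ jD; rewrite mem_nth.
  rewrite ltnS => iD jD; case: ifP => [ow|_]; last by rewrite IH.
  case/hasP: dis; exists (nth d (nth [::] D i) j) => //.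
  by apply/flattenP; exists (nth [::] D i); rewrite mem_nth.
split=> //; rewrite /cpos ec.
apply: index_uniq => //.
elim: D i uD iD {jD o ec} => [|w D IH] [|i] //=; rewrite cat_uniq => /and3P[uw _ uD] //.
by rewrite ltnS; apply: IH.
Qed.

Lemma onth_last (T : Type) (x : T) s : 0 < size s -> onth s (size s).-1 = Some (last x s).
Proof. by case: s => //= y s _; elim: s y => //= z s IH y; apply: IH. Qed.

Lemma in_out_col (X : cdiag occ) o u : uniq (flatten (erase X)) -> closed X ->
  (o, u) \in arcs X ->
  in_col (erase X) (to_cs X) o = Some u.1 /\ out_col (erase X) (to_cs X) o = Some u.2.
Proof.
move=> uX cX /flattenP[E /mapP[c cX' ->{E}] ouc].
pose i := index c X; pose j := index (o, u) c.2.
have iX : i < size X by rewrite index_mem.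
have jc : j < size c.2 by rewrite index_mem.
have ci : nth c X i = c by rewrite nth_index.
have wi : nth [::] (erase X) i = unzip1 c.2 by rewrite (nth_map c) ?ci.
have oj : o = nth o (unzip1 c.2) j.
  by rewrite /unzip1 (nth_map (o, u)) // nth_index.
have [] := @comp_pos (erase X) i j uX _ _ o; rewrite ?wi -?oj; try by rewrite size_map.
rewrite /in_col /out_col => -> ->; rewrite wi.
have -> : nth [::] (to_cs X) i = outs c.2.
  by rewrite (nth_map c) ?ci // /colors; case: (c.2) ouc.
have ch : chain c.1 c.2 c.1 by apply: (allP cX).
have [h1 h2] := chain_nth (o, u) jc ch.
have nj : nth (o, u) c.2 j = (o, u) by apply: nth_index.
rewrite nj /= in h1 h2; split=> //; rewrite -h1 /unzip1 size_map.
have lc := chain_last ch.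
have osz : size (outs c.2) = size c.2 by rewrite size_map.
(* The predecessor of the first passage is cyclically the last one; its outgoing color equals the
   base color by closedness. *)
case: (j) jc => [|j'] jc.
  by rewrite add0n modn_small ?prednK // -osz (onth_last c.1) ?osz // /= -lc.
by rewrite addSnnS prednK ?(leq_ltn_trans _ jc) // modnDr modn_small // ltnW.
Qed.

End Decorated.

(** * Crossing conditions, color lists and comparison of indices *)

Section Crossings.
Variables (BQ : finType) (ast circ : BQ -> BQ -> BQ).
Local Notation col2 := (BQ * BQ)%type.

(* [u] and [v] are the (incoming, outgoing) colors of the under- and over-strand. *)
Definition ok (s : bool) (u v : col2) : bool :=
  if s then (u.2 == ast u.1 v.2) && (v.1 == circ v.2 u.1)
  else (u.1 == ast u.2 v.1) && (v.2 == circ v.1 u.2).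

Definition wt (s : bool) (u v : col2) : col2 := if s then (u.1, v.2) else (u.2, v.1).

Definition cross (E : dword BQ occ) l s u v :=
  ((l, false, s), u) \in E /\ ((l, true, s), v) \in E.

(** Meaningful for any decorated word, not only for a full diagram: it constrains only crossings
    with both passages in [E], so it applies separately to a context and to the fillings of its
    holes. *)
Definition valid (E : dword BQ occ) := forall l s u v, cross E l s u v -> ok s u v.

Definition col (D : diagram) (X : cdiag BQ occ) :=
  [/\ erase X = D, closed X & valid (arcs X)].

Lemma eq_cross (E F : dword BQ occ) l s u v : E =i F -> cross E l s u v <-> cross F l s u v.
Proof. by move=> eEF; rewrite /cross !eEF. Qed.

Lemma eq_valid (E F : dword BQ occ) : E =i F -> valid E -> valid F.
Proof. by move=> eEF vE l s u v /(eq_cross _ _ _ _ eEF); apply: vE. Qed.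

Lemma mem_crossings D l : (l \in crossings D) = (l \in map olabel (flatten D)).
Proof. by rewrite mem_undup. Qed.

Lemma csignE (D : diagram) l b s : good (flatten D) -> (l, b, s) \in flatten D -> csign D l = s.
Proof.
move=> [_ gD] oD; rewrite /csign.
have hasl : has (fun o => olabel o == l) (flatten D) by apply/hasP; exists (l, b, s) => /=.
have := nth_find (0, false, false) hasl; have := mem_nth (0, false, false); rewrite has_find in hasl.
move=> /(_ _ _ hasl); case: (nth _ _ _) => [[l' b'] s'] /= oD' /eqP el.
by rewrite /olabel /= in el; subst l'; move: oD'; rewrite (gD l b s) // => /eqP.
Qed.

Lemma unzip1_mem (T : eqType) (E : dword BQ T) o u : (o, u) \in E -> o \in unzip1 E.
Proof. by move=> oE; apply/mapP; exists (o, u). Qed.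

Lemma cross_ex (X : cdiag BQ occ) l : good (flatten (erase X)) -> l \in crossings (erase X) ->
  exists s u v, cross (arcs X) l s u v.
Proof.
move=> [_ gX]; rewrite mem_crossings => /mapP[[[l' b] s] oX ->].
have := gX l' b s true s oX; have := gX l' b s false s oX.
rewrite eqxx -!arcs_erase => /mapP[[o u] oE /= eo] /mapP[[o' v] oE' /= eo'].
by exists s, u, v; split; rewrite ?eo ?eo'.
Qed.

Lemma cross_label E l s u v : cross E l s u v -> l \in map olabel (unzip1 E).
Proof. by move=> [/unzip1_mem oE _]; apply/mapP; exists (l, false, s). Qed.

Lemma dword_fun (T : eqType) (E : dword BQ T) o u v :
  uniq (unzip1 E) -> (o, u) \in E -> (o, v) \in E -> u = v.
Proof.
elim: E => //= -[o' w] E IH /= /andP[nE uE]; rewrite !inE !xpair_eqE.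
case: eqP => [->|_] /=; last exact: IH.
by move=> /predU1P[->|/unzip1_mem]; rewrite ?(negPf nE) // => /predU1P[->|/unzip1_mem]; rewrite ?(negPf nE).
Qed.

Lemma cross_fun E l s u v s' u' v' : good (unzip1 E) ->
  cross E l s u v -> cross E l s' u' v' -> [/\ s = s', u = u' & v = v'].
Proof.
move=> [uE gE] [c1 c2] [c3 c4].
have es : s' = s by apply/eqP; rewrite -(gE l false s false s') ?(unzip1_mem c1) ?(unzip1_mem c3).
by subst s'; split; [|exact: dword_fun c1 c3|exact: dword_fun c2 c4].
Qed.

Lemma cross_colsE X l s u v : good (flatten (erase X)) -> closed X ->
  cross (arcs X) l s u v ->
  cross_ok ast circ (erase X) (to_cs X) l = ok s u v /\
  cweight (erase X) (to_cs X) l = Some (wt s u v).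
Proof.
move=> gX cX [c1 c2].
have es : csign (erase X) l = s.
  by apply: (csignE (b := false)) => //; rewrite -arcs_erase; apply: unzip1_mem c1.
have uX := gX.1.
have [i1 o1] := in_out_col uX cX c1; have [i2 o2] := in_out_col uX cX c2.
by rewrite /cross_ok /cweight /cross_cols es i1 o1 i2 o2 /ok /wt; case: (s).
Qed.

Lemma mem_all_lists n c : (c \in all_lists BQ n) = (size c == n).
Proof.
elim: n c => [|n IH] c /=; first by rewrite inE; case: c.
apply/allpairsP/idP => [[[x s] /= [_ sn ->]]|]; first by rewrite eqSS -IH.
by case: c => // x s; rewrite eqSS -IH => sn; exists (x, s); rewrite mem_enum.
Qed.

Lemma uniq_all_lists n : uniq (all_lists BQ n).
Proof.
elim: n => //= n IH; apply: allpairs_uniq => //; first exact: enum_uniq.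
by move=> [x s] [y t] _ _ /= [-> ->].
Qed.

Lemma mem_all_shaped sh cs : (cs \in all_shaped BQ sh) = (map size cs == sh).
Proof.
elim: sh cs => [|n sh IH] cs /=; first by rewrite inE; case: cs.
apply/allpairsP/idP => [[[c s] /= [cn ssh ->]]|] /=.
  by rewrite eqseq_cons -mem_all_lists cn -IH.
case: cs => //= c s; rewrite eqseq_cons -mem_all_lists -IH => /andP[cn ssh].
by exists (c, s).
Qed.

Lemma uniq_all_shaped sh : uniq (all_shaped BQ sh).
Proof.
elim: sh => //= n sh IH; apply: allpairs_uniq => //; first exact: uniq_all_lists.
by move=> [x s] [y t] _ _ /= [-> ->].
Qed.

Lemma uniq_colorings D : uniq (colorings ast circ D).
Proof. by apply: filter_uniq; apply: uniq_all_shaped. Qed.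

Lemma coloringsP D cs : good (flatten D) ->
  cs \in colorings ast circ D <-> exists2 X, col D X & to_cs X = cs.
Proof.
move=> gD; rewrite mem_filter mem_all_shaped; split.
  move=> /andP[/allP cok /eqP/shaped_cdiag[X [eX cX ecs]]]; subst D cs.
  exists X => //; split=> // l s u v cr.
  rewrite -(cross_colsE gD cX cr).1; apply: cok.
  by rewrite mem_crossings -arcs_erase; apply: cross_label cr.
move=> [X [eX cX vX] <-]; subst D; apply/andP; split; last first.
  by apply/eqP/shaped_cdiag; exists X.
apply/allP => l /(cross_ex gD)[s [u [v cr]]].
by rewrite (cross_colsE gD cX cr).1; apply: vX cr.
Qed.

Definition wclass D (cs : seq (seq BQ)) l : option (GBQ ast circ) :=
  omap (ggen ast circ) (cweight D cs l).

Lemma sum_count (I : Type) (r : seq I) (p : pred I) :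
  (\sum_(i <- r) (if p i then 1 else 0))%R = Posz (count p r).
Proof.
elim: r => [|i r IH]; rewrite ?big_nil ?big_cons //= IH.
by case: (p i).
Qed.

Lemma cindexE D l h :
  @cindex BQ ast circ D l h = Posz (count (fun cs => pbool (wclass D cs l = Some h)) (colorings ast circ D)).
Proof.
rewrite -sum_count /cindex; apply: eq_bigr => cs _; rewrite /wclass.
case: (cweight _ _ _) => [p|] /=; last by case: pboolP.
by rewrite (@pbool_iff (ggen ast circ p = h) (Some (ggen ast circ p) = Some h)) //; split=> [->|[]].
Qed.

(** The third clause compares only labels present in both diagrams, and only up to the group:
    crossings created by a move are unconstrained, and R3 does change the weights themselves. *)
Definition embeds (D D' : diagram) := exists R : cdiag BQ occ -> cdiag BQ occ -> Prop,
  [/\ forall X, col D X -> exists2 X', col D' X' & R X X',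
      forall X Y X', col D X -> col D Y -> col D' X' -> R X X' -> R Y X' -> X = Y &
      forall X X', col D X -> col D' X' -> R X X' ->
        forall l s u v s' u' v', cross (arcs X) l s u v -> cross (arcs X') l s' u' v' ->
        ggen ast circ (wt s u v) = ggen ast circ (wt s' u' v')].

Lemma embeds_count D D' : good (flatten D) -> good (flatten D') -> embeds D D' ->
  size (colorings ast circ D) <= size (colorings ast circ D') /\
  forall l, l \in crossings D -> l \in crossings D' -> forall h,
   count (fun cs => pbool (wclass D cs l = Some h)) (colorings ast circ D) <=
   count (fun cs => pbool (wclass D' cs l = Some h)) (colorings ast circ D').
Proof.
move=> gD gD' [R [tot inj Rw]].
pose R' cs cs' := exists X X', [/\ col D X, col D' X', R X X', to_cs X = cs & to_cs X' = cs'].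
have tot' cs : cs \in colorings ast circ D -> exists2 cs', cs' \in colorings ast circ D' & R' cs cs'.
  move=> /(coloringsP _ gD)[X cX <-]; have [X' cX' RX] := tot X cX.
  exists (to_cs X'); first by apply/(coloringsP _ gD'); exists X'.
  by exists X, X'.
have inj' cs ds cs' : R' cs cs' -> R' ds cs' -> cs = ds.
  move=> [X [X' [cX cX' RX <- <-]]] [Y [Y' [cY cY' RY <- eX]]].
  (* [R'] speaks of color lists through decorations; these are unique by [to_cs_inj], so injectivity
     of [R] transfers. *)
  have eXY : X' = Y'.
    by case: cX' cY' => [e1 c1 _] [e2 c2 _]; apply: to_cs_inj; rewrite ?e1.
  by subst Y'; rewrite (inj X Y X').
split.
  rewrite -!(count_predT (colorings _ _ _)).
  apply: (leq_count_rel (R := R')) => //; try exact: uniq_colorings.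
  by move=> x y x' _ _ _; apply: inj'.
move=> l lD lD' h; apply: (leq_count_rel (R := R')) => //; try exact: uniq_colorings.
  by move=> x y x' _ _ _; apply: inj'.
move=> _ _ _ _ [X [X' [cX cX' RX <- <-]]] /pboolP eh; apply/pboolP; rewrite -eh.
case: (cX) => e1 c1 _; case: (cX') => e2 c2 _.
have [s [u [v cr]]] : exists s u v, cross (arcs X) l s u v by apply: cross_ex; rewrite e1.
have [s' [u' [v' cr']]] : exists s u v, cross (arcs X') l s u v by apply: cross_ex; rewrite e2.
rewrite /wclass -e1 -e2 (cross_colsE _ c1 cr).2 ?e1 // (cross_colsE _ c2 cr').2 ?e2 //=.
by rewrite (Rw X X' cX cX' RX _ _ _ _ _ _ _ cr cr').
Qed.

Lemma embeds_index D D' : good (flatten D) -> good (flatten D') -> embeds D D' -> embeds D' D ->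
  size (colorings ast circ D) = size (colorings ast circ D') /\
  forall l, l \in crossings D -> l \in crossings D' ->
   @cindex BQ ast circ D l = @cindex BQ ast circ D' l.
Proof.
move=> gD gD' emb emb'; have [h1 h2] := embeds_count gD gD' emb.
have [h3 h4] := embeds_count gD' gD emb'; split; first by apply/eqP; rewrite eqn_leq h1.
move=> l lD lD'; apply: functional_extensionality => h; rewrite !cindexE.
by congr Posz; apply/eqP; rewrite eqn_leq h2 ?h4.
Qed.

End Crossings.

(** * Biquandle algebra at one crossing, at a kink and at a triangle *)

Section Biquandle.
Variables (BQ : finType) (ast circ : BQ -> BQ -> BQ).
Hypothesis HBQ : biquandle ast circ.
Local Notation ok := (ok ast circ).
Local Notation gen x y := (ggen ast circ (x, y)).

Definition swap (T : Type) (u : T * T) := (u.2, u.1).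

(** Exchanging incoming and outgoing colors on both strands turns the negative condition into the
    positive one, which later allows assuming a positive crossing. *)
Lemma ok_swap s u v : ok (~~ s) (swap u) (swap v) = ok s u v.
Proof. by case: s. Qed.

Lemma wt_swap s (u v : BQ * BQ) : wt (~~ s) (swap u) (swap v) = wt s u v.
Proof. by case: s. Qed.

Lemma ast_inj x : injective (fun z => ast z x).
Proof. by case: HBQ => _ [h _]; apply: bij_inj. Qed.

Lemma circ_inj x : injective (fun z => circ z x).
Proof. by case: HBQ => _ [_ [h _]]; apply: bij_inj. Qed.

Lemma S_inj x y x' y' : circ y x = circ y' x' -> ast x y = ast x' y' -> x = x' /\ y = y'.
Proof.
case: HBQ => _ [_ [_ [/bij_inj h _]]] e1 e2.
by have [] := h (x, y) (x', y') (congr2 pair e1 e2).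
Qed.

Lemma ast_surj x y : exists z, ast z x = y.
Proof. by case: HBQ => _ [/(_ x)[f _ h] _]; exists (f y). Qed.

Lemma circ_surj x y : exists z, circ z x = y.
Proof. by case: HBQ => _ [_ [/(_ x)[f _ h] _]]; exists (f y). Qed.

Lemma S_surj x y : exists p q, circ q p = x /\ ast p q = y.
Proof.
case: HBQ => _ [_ [_ [[f _ h] _]]]; exists (f (x, y)).1, (f (x, y)).2.
by have [] := h (x, y).
Qed.

(* Squaring is injective because S (z, z) = (z o z, z o z), hence onto by finiteness. *)
Lemma square_inj : injective (fun z => circ z z).
Proof.
move=> x y /= e; have [] // := @S_inj x x y y e.
by case: HBQ => h _; rewrite !h.
Qed.

Lemma square_surj y : exists z, circ z z = y.
Proof. by have [f _ h] := injF_bij square_inj; exists (f y). Qed.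

(** At a positive crossing, knowing the two incoming colors uses injectivity of [circ], the incoming
    under- and outgoing over-color nothing, the outgoing under- and incoming over-color injectivity
    of S, and the two outgoing colors injectivity of [ast]. *)
Lemma ok_inj s u v u' v' : ok s u v -> ok s u' v' ->
  u.1 = u'.1 \/ u.2 = u'.2 -> v.1 = v'.1 \/ v.2 = v'.2 -> u = u' /\ v = v'.
Proof.
wlog -> : s u v u' v' / s = true.
  move=> H; case: s; first exact: H.
  rewrite -(ok_swap _ u) -(ok_swap _ u') => o o' e e'.
  have [] := H true (swap u) (swap v) (swap u') (swap v') erefl o o' => /=; try tauto.
  by case: (u) (v) (u') (v') => [? ?] [? ?] [? ?] [? ?] [-> ->] [-> ->].
case: u v u' v' => [a b] [c d] [a' b'] [c' d']; rewrite /ok /=.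
move=> /andP[/eqP-> /eqP->] /andP[/eqP-> /eqP->] [ea|eb] [ec|ed]; subst.
- by rewrite (circ_inj ec).
- by [].
- by have [-> ->] := S_inj ec eb.
- by rewrite (ast_inj eb).
Qed.

Lemma ok_ex s (i j : bool) x y : exists u v,
  [/\ ok s u v, (if i then u.1 else u.2) = x & (if j then v.1 else v.2) = y].
Proof.
wlog -> : s i j / s = true.
  move=> H; case: s; first exact: H.
  have [u [v [o <- <-]]] := H true (~~ i) (~~ j) erefl.
  by exists (swap u), (swap v); rewrite -(ok_swap true) in o; case: i j {H} o => [] [].
rewrite /ok; case: i j => [] [].
- have [z <-] := circ_surj x y; exists (x, ast x z), (circ z x, z); split=> //=; by rewrite !eqxx.
- exists (x, ast x y), (circ y x, y); split=> //=; by rewrite !eqxx.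
- have [p [q [<- <-]]] := S_surj y x; exists (p, ast p q), (circ q p, q); split=> //=; by rewrite !eqxx.
- have [z <-] := ast_surj y x; exists (z, ast z y), (circ y z, y); split=> //=; by rewrite !eqxx.
Qed.

(** The hypothesis says that S sends [(x, y)] to a diagonal pair. Squares exhaust [BQ], so that pair
    is also S of some [(z, z)], and S is injective. *)
Lemma S_diag x y : ast x y = circ y x -> x = y.
Proof.
move=> e; have [z ez] := square_surj (circ y x).
have ez' : ast z z = circ y x by case: HBQ => -> _.
by have [-> ->] := @S_inj x y z z (esym ez) (etrans e (esym ez')).
Qed.

(** Here [b] tells whether the first passage is the over one, and [y] colors the loop. If [s] equals
    [b], both outer colors are squares of [y], equal by the first axiom. Otherwise [y] is at once an
    [ast] and a [circ] of the outer colors, and [S_diag] applies. *)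
Lemma kink s (b : bool) x y z : (if b then ok s (y, z) (x, y) else ok s (x, y) (y, z)) ->
  x = z /\ exists t, wt s (if b then (y, z) else (x, y)) (if b then (x, y) else (y, z)) = (t, t).
Proof.
have sq t : ast t t = circ t t by case: HBQ => -> _.
case: s b => [] []; rewrite /ok /wt /= => /andP[/eqP e /eqP e'].
- by rewrite e e' sq; split=> //; exists y.
- by have <- : x = z by [apply: S_diag; rewrite -e -e']; split=> //; exists x.
- by have <- : z = x by [apply: S_diag; rewrite -e -e']; split=> //; exists z.
- by rewrite e e' sq; split=> //; exists y.
Qed.

Lemma kink_ex s (b : bool) x : exists y, if b then ok s (y, x) (x, y) else ok s (x, y) (y, x).
Proof.
have sq t : ast t t = circ t t by case: HBQ => -> _.
case: s b => [] []; rewrite /ok /=.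
- by have [y <-] := square_surj x; exists y; rewrite sq !eqxx.
- by exists (ast x x); rewrite sq !eqxx.
- by exists (ast x x); rewrite sq !eqxx.
- by have [y <-] := square_surj x; exists y; rewrite sq !eqxx.
Qed.

Lemma kink_inj s (b : bool) x y y' :
  (if b then ok s (y, x) (x, y) else ok s (x, y) (y, x)) ->
  (if b then ok s (y', x) (x, y') else ok s (x, y') (y', x)) -> y = y'.
Proof. by case: b => o o'; have [] := ok_inj o o'; auto => -[]. Qed.

(** An element of [GBQ] is the predicate of all words equivalent to a given one, so equality of
    classes comes from extensionality, with proof irrelevance for the attached witness. *)
Lemma gclass_eq (p q : BQ * BQ) : Defs.grel ast circ [:: (p, true)] [:: (q, true)] ->
  ggen ast circ p = ggen ast circ q.
Proof.
move=> pq; apply: eq_sig_hprop => [P|/=]; first exact: proof_irrelevance.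
apply: functional_extensionality => w; apply: propositional_extensionality.
split; apply: grel_trans => //; exact: grel_sym.
Qed.

Lemma ggen_diag x : gen x x = gunit ast circ.
Proof.
apply: eq_sig_hprop => [P|/=]; first exact: proof_irrelevance.
apply: functional_extensionality => w; apply: propositional_extensionality.
have h := grel_id ast circ x.
split; apply: grel_trans => //; exact: grel_sym.
Qed.

(* Crossing relation in terms of sides: [ur], [ul] are the colors of the under-arcs
   to the right and left of the over-strand, [vr], [vl] those of the over-arcs to
   the right and left of the under-strand; the weight is then [(ur, vr)]. *)
Definition side_rel ur vr ul vl : Prop := ul = ast ur vr /\ vl = circ vr ur.

Definition pick (s : bool) (x y : BQ) := if s then x else y.

Lemma okE s u v : ok s u v <->
  if s then side_rel u.1 v.2 u.2 v.1 else side_rel u.2 v.1 u.1 v.2.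
Proof. by rewrite /ok /side_rel; case: s; split=> [/andP[/eqP-> /eqP->]|[-> ->]]; rewrite ?eqxx. Qed.

(* A top, a middle and a bottom line bounding a triangle lying on the sides [sT], [sM],
   [sB] of them ([true] for right). [t], [m], [b] are the sides of the triangle, and
   e.g. [t1] and [t2] the arcs of the top line beyond the middle and the bottom line.
   If all six crossings of the two triangles are considered together, every color is
   a function of those of the three arcs lying to the right of both other lines. *)
Lemma triangle (sT sM sB : bool) t t1 t2 m m1 m2 b b1 b2 :
  side_rel (pick sT m m1) (pick sM t t1) (pick sT m1 m) (pick sM t1 t) ->
  side_rel (pick sT b b1) (pick sB t t2) (pick sT b1 b) (pick sB t2 t) ->
  side_rel (pick sM b b2) (pick sB m m2) (pick sM b2 b) (pick sB m2 m) ->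
  exists t' m' b',
  [/\ side_rel (pick sT m2 m') (pick sM t2 t') (pick sT m' m2) (pick sM t' t2) /\
      gen (pick sT m m1) (pick sM t t1) = gen (pick sT m2 m') (pick sM t2 t'),
      side_rel (pick sT b2 b') (pick sB t1 t') (pick sT b' b2) (pick sB t' t1) /\
      gen (pick sT b b1) (pick sB t t2) = gen (pick sT b2 b') (pick sB t1 t') &
      side_rel (pick sM b1 b') (pick sB m1 m') (pick sM b' b1) (pick sB m' m1) /\
      gen (pick sM b b2) (pick sB m m2) = gen (pick sM b1 b') (pick sB m1 m')].
Proof.
have [_ [_ [_ [_ [ax1 [ax2 ax3]]]]]] := HBQ.
have g1 x y z : gen x y = gen (ast x z) (ast y z) by apply: gclass_eq; apply: grel_rel1.
have g2 x y z : gen y z = gen (circ y x) (circ z x) by apply: gclass_eq; apply: grel_rel2.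
have g3 x y z : gen x z = gen (ast x y) (circ z y) by apply: gclass_eq; apply: grel_rel3.
have cube x y z : [/\ circ (circ z x) (circ y x) = circ (circ z y) (ast x y),
    ast (circ y x) (circ z x) = circ (ast y z) (ast x z) &
    ast (ast x y) (circ z y) = ast (ast x z) (ast y z)] by [].
(* In each case [cube] takes the bottom, middle and top arcs lying to the right of both other lines.
   Such an arc is a side of the old triangle if both flags of the other lines are true, an outer arc
   if they differ, and a side of the new triangle if both are false. *)
case: sT sM sB => [] [] []; rewrite /pick; move=> [e1 e2] [e3 e4] [e5 e6].
- have [c1 c2 c3] := cube b m t; move: (g1 b m t) (g2 b m t) (g3 b m t) => w1 w2 w3.
  exists (circ t1 b2), (ast m2 t2), (ast b1 m1).
  by split; (split; [split|]; congruence).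
- have [c1 c2 c3] := cube b m2 t2; move: (g1 b m2 t2) (g2 b m2 t2) (g3 b m2 t2) => w1 w2 w3.
  exists (circ t2 m2), (ast m2 t2), (ast b1 (ast m2 t2)).
  by split; (split; [split|]; congruence).
- have [c1 c2 c3] := cube b2 m t1; move: (g1 b2 m t1) (g2 b2 m t1) (g3 b2 m t1) => w1 w2 w3.
  exists (circ t1 b2), (ast m2 (circ t1 b2)), (ast b2 t1).
  by split; (split; [split|]; congruence).
(* The right-hand arc of the top line is a side of the new triangle, hence found by inverting an
   operation at one of its ends; the relation at its other end follows by cancellation. *)
- have [z ez] := circ_surj b2 t1; have ez' : t2 = circ z m2.
    by apply: (@circ_inj b); case: (cube b2 m2 z) => c1 _ _; congruence.
  have [c1 c2 c3] := cube b2 m2 z; move: (g1 b2 m2 z) (g2 b2 m2 z) (g3 b2 m2 z) => w1 w2 w3.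
  exists z, (ast m2 z), (ast b2 z).
  by split; (split; [split|]; congruence).
- have [c1 c2 c3] := cube b1 m1 t; move: (g1 b1 m1 t) (g2 b1 m1 t) (g3 b1 m1 t) => w1 w2 w3.
  exists (circ t2 (circ m1 b1)), (circ m1 b1), (ast b1 m1).
  by split; (split; [split|]; congruence).
- have [z ez] := circ_surj b1 m1; have ez' : m2 = ast z t2.
    by apply: (@circ_inj b); case: (cube b1 z t2) => c1 c2 _; congruence.
  have [c1 c2 c3] := cube b1 z t2; move: (g1 b1 z t2) (g2 b1 z t2) (g3 b1 z t2) => w1 w2 w3.
  exists (circ t2 z), z, (ast b1 z).
  by split; (split; [split|]; congruence).
- have [z ez] := ast_surj m1 b1; have ez' : b2 = ast z t1.
    by apply: (@ast_inj m); case: (cube z m1 t1) => c1 c2 c3; congruence.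
  have [c1 c2 c3] := cube z m1 t1; move: (g1 z m1 t1) (g2 z m1 t1) (g3 z m1 t1) => w1 w2 w3.
  exists (circ t1 z), (circ m1 z), z.
  by split; (split; [split|]; congruence).
(* All three right-hand arcs belong to the new triangle: S is inverted at the middle-bottom
   crossing, then [circ] on the top line. *)
- have [x [y [ex ey]]] := S_surj m1 b1; have [z ez] := circ_surj x t1.
  have [c1 c2 c3] := cube x y z; move: (g1 x y z) (g2 x y z) (g3 x y z) => w1 w2 w3.
  have ez' : t2 = circ z y by apply: (@circ_inj b1); congruence.
  have [eb2 em2] : b2 = ast x z /\ m2 = ast y z by apply: S_inj; congruence.
  exists z, y, x.
  by split; (split; [split|]; congruence).
Qed.

End Biquandle.

(** * Cutting colored Gauss codes at the holes of a context *)

Section Plug.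

(** Generic in the letters, because it fills both bare Gauss words and, after [tag], decorated
    ones. *)
Definition plug (A : Type) (P : nat -> seq A) (w : seq (A + nat)) : seq A :=
  flatten [seq match it with inl o => [:: o] | inr k => P k end | it <- w].
Definition inls (A : Type) (w : seq (A + nat)) : seq A :=
  pmap (fun it => if it is inl o then Some o else None) w.
Definition inrs (A : Type) (w : seq (A + nat)) : seq nat :=
  pmap (fun it => if it is inr k then Some k else None) w.

Lemma fillE C P : fill C P = map (plug P) C. Proof. by []. Qed.
Lemma ctx_labelsE C : ctx_labels C = map olabel (inls (flatten C)). Proof. by []. Qed.
Lemma holesE C : holes C = inrs (flatten C). Proof. by []. Qed.

Lemma plug_cat (A : Type) (P : nat -> seq A) w1 w2 :
  plug P (w1 ++ w2) = plug P w1 ++ plug P w2.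
Proof. by rewrite /plug map_cat flatten_cat. Qed.

Lemma plug_flatten (A : Type) (P : nat -> seq A) (C : seq (seq (A + nat))) :
  flatten (map (plug P) C) = plug P (flatten C).
Proof. by elim: C => //= w C ->; rewrite plug_cat. Qed.

Lemma plug_perm (A : eqType) (P : nat -> seq A) w :
  perm_eq (plug P w) (inls w ++ flatten (map P (inrs w))).
Proof.
elim: w => //= -[o|k] w IH /=; first by rewrite perm_cons.
by rewrite [plug _ _]/(P k ++ plug P w) perm_sym perm_catCA perm_cat2l perm_sym.
Qed.

Lemma eq_plug (A : Type) (P P' : nat -> seq A) w : {in inrs w, P =1 P'} -> plug P w = plug P' w.
Proof.
elim: w => //= -[o|k] w IH eP; first by congr (_ :: _); apply: IH.
rewrite [LHS]/(P k ++ plug P w) IH => [|j jw]; last by apply: eP; rewrite /= inE jw orbT.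
by rewrite eP //= mem_head.
Qed.

Lemma inrs_cat (A : Type) (w1 w2 : seq (A + nat)) : inrs (w1 ++ w2) = inrs w1 ++ inrs w2.
Proof. exact: pmap_cat. Qed.

Lemma mem_inrs (A : eqType) (w : seq (A + nat)) k : (k \in inrs w) = (inr k \in w).
Proof.
elim: w => //= -[o|j] w IH; rewrite !inE IH //.
Qed.

Lemma flatten_fill_perm C P :
  perm_eq (flatten (fill C P)) (inls (flatten C) ++ flatten (map P (holes C))).
Proof. by rewrite fillE plug_flatten; apply: plug_perm. Qed.

Variable BQ : finType.

Definition tag (A : Type) (it : (A + nat) * (BQ * BQ)) : A * (BQ * BQ) + nat :=
  match it.1 with inl o => inl (o, it.2) | inr k => inr k end.
Definition plugw (A : Type) (Q : nat -> dword BQ A) (E : dword BQ (A + nat)) : dword BQ A :=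
  plug Q (map (@tag A) E).
Definition fillX (A : Type) (Q : nat -> dword BQ A) (Y : cdiag BQ (A + nat)) : cdiag BQ A :=
  [seq (c.1, plugw Q c.2) | c <- Y].

Lemma inrs_tag (A : Type) (E : dword BQ (A + nat)) : inrs (map (@tag A) E) = inrs (unzip1 E).
Proof. by elim: E => //= -[[o|k] ab] E /= ->. Qed.

Lemma arcs_fillX (A : Type) (Q : nat -> dword BQ A) Y : arcs (fillX Q Y) = plugw Q (arcs Y).
Proof.
rewrite /plugw /arcs map_flatten -plug_flatten /fillX -!map_comp; congr flatten.
Qed.

Variable A : eqType.
Implicit Types (P : nat -> seq A) (Q : nat -> dword BQ A) (E : dword BQ (A + nat)).

(** A hole of a decorated context carries a pair of colors like any letter; it is read as the colors
    entering and leaving the filling. *)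
Definition fits P Q E := forall k ab, (inr k, ab) \in E ->
  chain ab.1 (Q k) ab.2 /\ unzip1 (Q k) = P k.

Lemma fits_cons P Q e E : fits P Q (e :: E) -> fits P Q E.
Proof. by move=> f k ab kE; apply: f; rewrite inE kE orbT. Qed.

Lemma fits_cat P Q E F : fits P Q (E ++ F) <-> fits P Q E /\ fits P Q F.
Proof.
split=> [f|[f g] k ab]; last by rewrite mem_cat => /orP[/f|/g].
by split=> k ab kE; apply: f; rewrite mem_cat kE ?orbT.
Qed.

Lemma plugw_cons Q it E : plugw Q (it :: E) =
  match it.1 with inl o => [:: (o, it.2)] | inr k => Q k end ++ plugw Q E.
Proof. by case: it => -[]. Qed.

Lemma plugw_chain P Q E x y : fits P Q E -> chain x E y ->
  chain x (plugw Q E) y /\ unzip1 (plugw Q E) = plug P (unzip1 E).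
Proof.
elim: E x => [|[it [a b]] E IH] x // f /= /andP[/eqP exa cE]; subst a.
have [c1 c2] := IH b (fits_cons f) cE; rewrite plugw_cons; case: it f => [o|k] f /=.
  by rewrite c1 c2 eqxx.
have [d1 d2] := f k (x, b) (mem_head _ _); split; first by apply/chain_cat; exists b.
by rewrite /unzip1 map_cat -/(unzip1 (Q k)) -/(unzip1 (plugw Q E)) c2 d2.
Qed.

Lemma fillX_colored P Q (Y : cdiag BQ (A + nat)) : fits P Q (arcs Y) -> closed Y ->
  closed (fillX Q Y) /\ erase (fillX Q Y) = map (plug P) (erase Y).
Proof.
elim: Y => //= -[x E] Y IH /fits_cat[f fY] /andP[/= cE cY].
have [h1 ->] := IH fY cY; have [h2 ->] := plugw_chain f cE.
by rewrite /= h2 h1.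
Qed.

(** At a hole, the decorated word is cut after [size (P k)] letters and the color at the cut becomes
    the leaving color of the hole. Holes must be distinct for the pieces to form one function
    [Q]. *)
Lemma plugw_split P (w : seq (A + nat)) (F : dword BQ A) x y :
  uniq (inrs w) -> unzip1 F = plug P w -> chain x F y ->
  exists E Q, [/\ unzip1 E = w, chain x E y, F = plugw Q E & fits P Q E].
Proof.
elim: w F x => [|[o|k] w IH] F x /=.
- by case: F => // _ _ /eqP->; exists [::], (fun=> [::]); rewrite /= eqxx.
- case: F => [|[o' [a b]] F] //= uw [-> eF] /andP[/eqP-> cF].
  have [E [Q [e1 e2 e3 e4]]] := IH F b uw eF cF.
  exists ((inl o, (x, b)) :: E), Q; rewrite /= eqxx e1 e2 e3; split=> //.
- move=> /andP[kw uw]; rewrite [plug _ _]/(P k ++ plug P w) => eF.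
  rewrite -(cat_take_drop (size (P k)) F) => /chain_cat[z c1 c2].
  have [|E [Q [e1 e2 e3 e4]]] := IH _ z uw _ c2.
    by rewrite /unzip1 map_drop -/(unzip1 F) eF drop_size_cat.
  exists ((inr k, (x, z)) :: E), (fun j => if j == k then take (size (P k)) F else Q j).
  have notk j : j \in inrs w -> (j == k) = false.
    by move=> jw; apply/eqP => ejk; rewrite -ejk jw in kw.
  rewrite plugw_cons /= !eqxx e1 e2; split=> //.
    congr (_ ++ _); rewrite e3; apply: eq_plug => j; rewrite inrs_tag e1.
    by move=> /notk ->.
  move=> j ab; rewrite inE => /predU1P[[-> ->]|jE].
    by rewrite eqxx; split=> //; rewrite /unzip1 map_take -/(unzip1 F) eF take_size_cat.
  by rewrite notk; [exact: e4 | rewrite -e1 mem_inrs (unzip1_mem jE)].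
Qed.

Lemma fillX_split P (C : seq (seq (A + nat))) (X : cdiag BQ A) :
  uniq (inrs (flatten C)) -> erase X = map (plug P) C -> closed X ->
  exists Y Q, [/\ erase Y = C, closed Y, X = fillX Q Y & fits P Q (arcs Y)].
Proof.
elim: C X => [|w C IH] [|[x F] X] //=.
  by exists [::], (fun=> [::]).
rewrite inrs_cat cat_uniq => /and3P[uw dis uC] [eF eX] /andP[/= cF cX].
have [Y [Q1 [e1 e2 e3 e4]]] := IH X uC eX cX.
have [E [Q2 [d1 d2 d3 d4]]] := plugw_split uw eF cF.
(* The first component and the remaining ones have disjoint holes, so their fillings can be
   merged. *)
pose Q k := if k \in inrs w then Q2 k else Q1 k.
have notw j : j \in inrs (flatten C) -> (j \in inrs w) = false.
  by move=> jC; apply/negP => jw; case/hasP: dis; exists j.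
have arcsY : unzip1 (arcs Y) = flatten C by rewrite arcs_erase e1.
exists ((x, E) :: Y), Q; rewrite /= e1 d1 d2 e2; split=> //.
  congr (_ :: _).
    by rewrite d3; congr (_, _); apply: eq_plug => j; rewrite inrs_tag d1 /Q => ->.
  rewrite e3; apply/eq_in_map => c cY; congr (_, _); apply: eq_plug => j.
  rewrite inrs_tag mem_inrs /Q => jc; rewrite notw // -arcsY mem_inrs.
  have /mapP[it itc ->] := jc; apply: map_f; apply/flattenP; exists c.2 => //.
  exact: map_f.
apply/fits_cat; split=> k ab kE; have := unzip1_mem kE; rewrite /Q.
  by rewrite d1 -mem_inrs => ->; apply: d4.
by rewrite arcsY -mem_inrs => /notw->; apply: e4.
Qed.

Lemma chain_fun (T : Type) x (E : dword BQ T) y z : chain x E y -> chain x E z -> y = z.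
Proof. by move=> /chain_last-> /chain_last->. Qed.

(** The common [P] fixes where fillings begin and end, and a filling with its entering color
    determines its leaving color, even when it is empty. So the colors erased at the holes are
    recovered. *)
Lemma plugw_inj P Q1 Q2 E1 E2 x y1 y2 : unzip1 E1 = unzip1 E2 ->
  chain x E1 y1 -> chain x E2 y2 -> fits P Q1 E1 -> fits P Q2 E2 ->
  plugw Q1 E1 = plugw Q2 E2 -> E1 = E2 /\ {in inrs (unzip1 E1), Q1 =1 Q2}.
Proof.
elim: E1 E2 x => [|[it [a b]] E1 IH] [|[it' [a' b']] E2] x //= [<- eE].
move=> /andP[/eqP-> c1] /andP[/eqP-> c2] f1 f2; rewrite !plugw_cons.
case: it f1 f2 => [o|k] f1 f2 /=.
  move=> [ebb ep]; subst b'; have [-> ?] := IH E2 b eE c1 c2 (fits_cons f1) (fits_cons f2) ep.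
  by split.
have [[d1 u1] [d2 u2]] := (f1 k (x, b) (mem_head _ _), f2 k (x, b') (mem_head _ _)).
have sz : size (Q1 k) = size (Q2 k).
  by rewrite -[LHS](size_map fst) -[RHS](size_map fst) -/(unzip1 _) u1 -u2.
move=> /eqP; rewrite eqseq_cat // => /andP[/eqP eQ /eqP ep].
rewrite /= eQ in d1; have ebb := chain_fun d1 d2; rewrite /= in ebb; subst b'.
have [-> h] := IH E2 b eE c1 c2 (fits_cons f1) (fits_cons f2) ep.
by split=> // j; rewrite inE => /predU1P[->//|]; apply: h.
Qed.

Lemma fillX_inj P Q1 Q2 (Y1 Y2 : cdiag BQ (A + nat)) : erase Y1 = erase Y2 ->
  closed Y1 -> closed Y2 -> fits P Q1 (arcs Y1) -> fits P Q2 (arcs Y2) ->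
  fillX Q1 Y1 = fillX Q2 Y2 -> Y1 = Y2 /\ {in inrs (flatten (erase Y1)), Q1 =1 Q2}.
Proof.
elim: Y1 Y2 => [|[x E] Y1 IH] [|[x' E'] Y2] //= [eE eY] /andP[/= c1 cY1] /andP[/= c2 cY2].
move=> /fits_cat[f1 fY1] /fits_cat[f2 fY2] [exx ep eF]; subst x'.
have [-> h] := IH Y2 eY cY1 cY2 fY1 fY2 eF.
have [-> h'] := plugw_inj eE c1 c2 f1 f2 ep.
by split=> // k; rewrite inrs_cat mem_cat => /orP[/h'|/h].
Qed.

End Plug.

(** * From local extension of fillings to embeddings of colorings *)

Section Local.
Variables (BQ : finType) (ast circ : BQ -> BQ -> BQ).
Local Notation ok := (ok ast circ).
Local Notation valid := (valid ast circ).
Local Notation gwt s u v := (ggen ast circ (wt s u v)).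
Implicit Types (P : nat -> seq occ) (Q : nat -> dword BQ occ) (bd : nat -> BQ * BQ).

Definition labels (E : dword BQ occ) : seq nat := map olabel (unzip1 E).

Lemma labels_cat E F : labels (E ++ F) = labels E ++ labels F.
Proof. by rewrite /labels /unzip1 !map_cat. Qed.

Lemma cross_catl E F l s u v : l \notin labels F -> cross (E ++ F) l s u v -> cross E l s u v.
Proof.
move=> lF [c1 c2]; split; [move: c1|move: c2];
  rewrite mem_cat => /orP[//|/unzip1_mem h]; case/mapP: lF; eexists; [exact: h|by []|exact: h|by []].
Qed.

Lemma cross_catr E F l s u v : l \notin labels E -> cross (E ++ F) l s u v -> cross F l s u v.
Proof.
move=> lE; rewrite (@eq_cross _ _ (F ++ E)); first exact: cross_catl.
by move=> x; rewrite !mem_cat orbC.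
Qed.

Lemma valid_cat E F : (forall l, l \in labels E -> l \notin labels F) ->
  valid (E ++ F) <-> valid E /\ valid F.
Proof.
move=> dis; split=> [v|[vE vF] l s u v cr].
  by split=> l s u v0 [c1 c2]; apply: (v l); split; rewrite mem_cat ?c1 ?c2 ?orbT.
case: (boolP (l \in labels E)) => lE.
  by apply: (vE l); apply: cross_catl cr; apply: dis.
by apply: (vF l); apply: cross_catr cr.
Qed.

Definition local_col hs P bd Q :=
  (forall k, k \in hs -> chain (bd k).1 (Q k) (bd k).2 /\ unzip1 (Q k) = P k) /\
  valid (flatten (map Q hs)).

Definition same_weights (E F : dword BQ occ) := forall l s u v s' u' v',
  cross E l s u v -> cross F l s' u' v' -> gwt s u v = gwt s' u' v'.

(** The second half concerns [P] alone. It yields injectivity globally: colorings with the same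
    image share the context coloring, hence the boundary colors, hence the fillings. *)
Definition local_embeds hs P P' :=
  (forall bd Q, local_col hs P bd Q -> exists Q', local_col hs P' bd Q' /\
     same_weights (flatten (map Q hs)) (flatten (map Q' hs))) /\
  (forall bd Q1 Q2, local_col hs P bd Q1 -> local_col hs P bd Q2 -> {in hs, Q1 =1 Q2}).

(** The default [d] makes [bd] total even though [BQ] might be empty; in a context with a hole, any
    letter of a coloring supplies it. *)
Lemma boundary (A : eqType) (E : dword BQ (A + nat)) (d : BQ * BQ) : uniq (inrs (unzip1 E)) ->
  exists bd, forall k ab, (inr k, ab) \in E -> bd k = ab.
Proof.
elim: E => [|[[o|k] ab] E IH] /=; first by exists (fun=> d).
  by move=> /IH[bd h]; exists bd => k' ab'; rewrite inE => /= /h.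
move=> /andP[kE /IH[bd h]]; exists (fun j => if j == k then ab else bd j) => j ab'.
rewrite inE => /predU1P[[-> ->]|jE]; first by rewrite eqxx.
have [ejk|_] := eqVneq j k; last exact: h.
by rewrite mem_inrs -ejk (unzip1_mem jE) in kE.
Qed.

Section Fill.
Variables (C : ctx) (hs : seq nat).
Hypotheses (pC : perm_eq (holes C) hs) (uhs : uniq hs) (hs0 : hs != [::]).

(** This keeps each crossing wholly inside the holes or wholly outside, so validity can be tested on
    the two parts separately. *)
Definition fresh P := forall k l, k \in hs -> l \in map olabel (P k) -> l \notin ctx_labels C.
Definition ctx_arcs (Y : cdiag BQ (occ + nat)) := inls (map (@tag BQ occ) (arcs Y)).

Lemma uniq_holes : uniq (inrs (flatten C)). Proof. by rewrite -holesE (perm_uniq pC). Qed.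

Lemma mem_hs k : (k \in hs) = (k \in inrs (flatten C)). Proof. by rewrite -(perm_mem pC). Qed.

Lemma arcs_fill Q Y : erase Y = C -> arcs (fillX Q Y) =i ctx_arcs Y ++ flatten (map Q hs).
Proof.
move=> eY; rewrite arcs_fillX; apply: perm_mem; apply: perm_trans (plug_perm _ _) _.
by rewrite perm_cat2l inrs_tag arcs_erase eY; apply: perm_flatten; apply: perm_map.
Qed.

Lemma ctx_arcs_labels Y : erase Y = C -> labels (ctx_arcs Y) = ctx_labels C.
Proof.
move=> <-; rewrite ctx_labelsE -arcs_erase /ctx_arcs /labels; congr map.
by elim: (arcs Y) => //= -[[o|k] ab] E /= <-.
Qed.

Lemma fill_boundary Y : erase Y = C ->
  exists bd : nat -> BQ * BQ, forall k ab, (inr k, ab) \in arcs Y -> bd k = ab.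
Proof.
move=> eY; have uY : uniq (inrs (unzip1 (arcs Y))) by rewrite arcs_erase eY uniq_holes.
case eA : (arcs Y) uY => [|e E] uY; last exact: boundary e.2 uY.
case: hs hs0 mem_hs => // k hs' _ /(_ k).
by rewrite mem_head -eY -arcs_erase eA.
Qed.

Lemma fits_local P Q Y bd : erase Y = C -> fits P Q (arcs Y) ->
  (forall k ab, (inr k, ab) \in arcs Y -> bd k = ab) ->
  forall k, k \in hs -> chain (bd k).1 (Q k) (bd k).2 /\ unzip1 (Q k) = P k.
Proof.
move=> eY f hbd k; rewrite mem_hs mem_inrs -eY -arcs_erase => /mapP[[it ab] kY /= ek].
by rewrite -ek in kY; rewrite (hbd _ _ kY); apply: f.
Qed.

Lemma fresh_labels P Q l : fresh P -> (forall k, k \in hs -> unzip1 (Q k) = P k) ->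
  l \in labels (flatten (map Q hs)) -> l \notin ctx_labels C.
Proof.
move=> d e /mapP[o]; rewrite /unzip1 map_flatten -map_comp => /flattenP[w /mapP[k kh ->]] ow ->.
by apply: (d _ _ kh); apply: map_f; rewrite -e.
Qed.

Lemma valid_fill P Q Y : erase Y = C -> fresh P ->
  (forall k, k \in hs -> unzip1 (Q k) = P k) ->
  valid (arcs (fillX Q Y)) <-> valid (ctx_arcs Y) /\ valid (flatten (map Q hs)).
Proof.
move=> eY d e; rewrite -valid_cat; last first.
  by move=> l; rewrite ctx_arcs_labels // => lC; apply/negP => /(fresh_labels d e); rewrite lC.
by split; apply: eq_valid => x; rewrite arcs_fill.
Qed.

Lemma col_fill P X : fresh P -> col ast circ (fill C P) X ->
  exists Y Q bd, [/\ X = fillX Q Y, [/\ erase Y = C, closed Y & fits P Q (arcs Y)],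
    forall k ab, (inr k, ab) \in arcs Y -> bd k = ab, valid (ctx_arcs Y) & local_col hs P bd Q].
Proof.
move=> d [eX cX vX]; have [Y [Q [eY cY eXY f]]] := fillX_split uniq_holes eX cX; subst X.
have [bd hbd] := fill_boundary eY; have lQ := fits_local eY f hbd.
have eQ k : k \in hs -> unzip1 (Q k) = P k by move=> /lQ[].
have [vC vQ] := (valid_fill eY d eQ).1 vX.
by exists Y, Q, bd.
Qed.

Lemma cross_fill P X : fresh P -> col ast circ (fill C P) X ->
  exists bd Q, local_col hs P bd Q /\ forall l s u v, l \notin ctx_labels C ->
    cross (arcs X) l s u v -> cross (flatten (map Q hs)) l s u v.
Proof.
move=> d cX; have [Y [Q [bd [-> [eY _ _] _ _ lQ]]]] := col_fill d cX.
exists bd, Q; split=> // l s u v lC /(eq_cross _ _ _ _ (arcs_fill Q eY)).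
by apply: cross_catr; rewrite ctx_arcs_labels.
Qed.

Lemma fill_embeds P P' : fresh P -> fresh P' ->
  good (flatten (fill C P)) -> local_embeds hs P P' -> embeds ast circ (fill C P) (fill C P').
Proof.
move=> dP dP' gD [ex un].
exists (fun X X' => exists Y Q Q', [/\ X = fillX Q Y, X' = fillX Q' Y,
   [/\ erase Y = C, closed Y, fits P Q (arcs Y) & fits P' Q' (arcs Y)] &
   same_weights (flatten (map Q hs)) (flatten (map Q' hs))]).
split.
- move=> X /(col_fill dP)[Y [Q [bd [-> [eY cY f] hbd vC lQ]]]].
  have [Q' [[lQ' vQ'] sw]] := ex bd Q lQ.
  have eQ' k : k \in hs -> unzip1 (Q' k) = P' k by move=> /lQ'[].
  have f' : fits P' Q' (arcs Y).
    move=> k ab kY; rewrite -(hbd _ _ kY); apply: lQ'.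
    by rewrite mem_hs mem_inrs -eY -arcs_erase; apply: unzip1_mem kY.
  exists (fillX Q' Y); last by exists Y, Q, Q'.
  have [c' e'] := fillX_colored f' cY; split=> //; first by rewrite e' eY.
  exact/(valid_fill eY dP' eQ').
- move=> X1 X2 X' [_ _ v1] [_ _ v2] _ [Y1 [Q1 [Q1' [e1 e1' [eY1 cY1 f1 f1'] _]]]].
  move=> [Y2 [Q2 [Q2' [e2 e2' [eY2 cY2 f2 f2'] _]]]]; subst X1 X2.
  have eYY : Y1 = Y2.
    by have [] := fillX_inj (etrans eY1 (esym eY2)) cY1 cY2 f1' f2' (etrans (esym e1') e2').
  subst Y2; have [bd hbd] := fill_boundary eY1.
  have l1 := fits_local eY1 f1 hbd; have l2 := fits_local eY1 f2 hbd.
  have u1 k : k \in hs -> unzip1 (Q1 k) = P k by move=> /l1[].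
  have u2 k : k \in hs -> unzip1 (Q2 k) = P k by move=> /l2[].
  have [_ w1] := (valid_fill eY1 dP u1).1 v1.
  have [_ w2] := (valid_fill eY1 dP u2).1 v2.
  have eQ := un bd Q1 Q2 (conj l1 w1) (conj l2 w2).
  apply/eq_in_map => c cY; congr (_, _); apply: eq_plug => k kc; apply: eQ.
  rewrite mem_hs -eY1 -arcs_erase mem_inrs; rewrite inrs_tag mem_inrs in kc.
  case/mapP: kc => it itc ->; apply: map_f; apply/flattenP; exists c.2 => //; exact: map_f.
- move=> X X' [eX _ _] _ [Y [Q [Q' [eXY eXY' [eY cY f f'] sw]]]] l s u v s' u' v'.
  subst X X'; have [bd hbd] := fill_boundary eY.
  have eQ' k : k \in hs -> unzip1 (Q' k) = P' k by move=> /(fits_local eY f' hbd)[].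
  move=> cr cr'; have cr1 := (eq_cross _ _ _ _ (arcs_fill Q eY)).1 cr.
  move: cr' => /(eq_cross _ _ _ _ (arcs_fill Q' eY)) cr'.
  (* A crossing of the context has the same decorated passages in both fillings, hence equal
     weights; any other label belongs to the fillings and is covered by [same_weights]. *)
  case: (boolP (l \in ctx_labels C)) => lC.
    have cr2 : cross (arcs (fillX Q Y)) l s' u' v'.
      apply/(eq_cross _ _ _ _ (arcs_fill Q eY)).
      have [|c1 c2] := cross_catl _ cr'; last by split; rewrite mem_cat ?c1 ?c2.
      by apply/negP => /(fresh_labels dP' eQ'); rewrite lC.
    have gX : good (unzip1 (arcs (fillX Q Y))) by rewrite arcs_erase eX.
    by have [-> -> ->] := cross_fun gX cr cr2.
  by apply: sw; [apply: cross_catr cr1|apply: cross_catr cr']; rewrite ctx_arcs_labels.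
Qed.

End Fill.

End Local.

(** * Local analysis of the Reidemeister moves *)

Section Moves.
Variables (BQ : finType) (ast circ : BQ -> BQ -> BQ).
Hypothesis HBQ : biquandle ast circ.
Local Notation ok := (ok ast circ).
Local Notation valid := (valid ast circ).
Local Notation gwt s u v := (ggen ast circ (wt s u v)).
Local Notation col2 := (BQ * BQ)%type.
Implicit Types (P : nat -> seq occ) (Q : nat -> dword BQ occ) (bd : nat -> BQ * BQ).

(* [okp] and [wtp] are [ok] and [wt] for a crossing whose first strand passes over iff [c]. *)
Definition okp (c s : bool) (p q : col2) := if c then ok s q p else ok s p q.
Definition wtp (c s : bool) (p q : col2) := if c then wt s q p else wt s p q.
Definition xing (l : nat) (c s : bool) (p q : col2) : dword BQ occ :=
  [:: ((l, c, s), p); ((l, ~~ c, s), q)].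

Lemma xing_cross l c s p q l' s' u v : cross (xing l c s p q) l' s' u v ->
  [/\ l' = l, s' = s & if c then u = q /\ v = p else u = p /\ v = q].
Proof.
rewrite /cross /xing !inE !xpair_eqE.
by case: c; rewrite /= ?andbF ?andbT ?orbF /= => -[/andP[/andP[/eqP-> /eqP->] /eqP->] /andP[_ /eqP->]].
Qed.

Lemma valid_xing l c s p q : valid (xing l c s p q) <-> okp c s p q.
Proof.
split=> [v|o l' s' u v /xing_cross[_ -> ]]; last by move: o; rewrite /okp; case: c => o [-> ->].
by rewrite /okp; case: c v => v; apply: (v l); split; rewrite !inE eqxx ?orbT.
Qed.

Lemma labels_xing l c s p q : labels (xing l c s p q) = [:: l; l].
Proof. by []. Qed.

Lemma word0 x (E : dword BQ occ) y : chain x E y -> unzip1 E = [::] -> E = [::] /\ x = y.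
Proof. by case: E => //= /eqP. Qed.

Lemma word2 x (E : dword BQ occ) y o1 o2 : chain x E y -> unzip1 E = [:: o1; o2] ->
  exists m, E = [:: (o1, (x, m)); (o2, (m, y))].
Proof.
case: E => [|[o [a b]] [|[o' [c d]] [|//]]] //= /and3P[/eqP-> /eqP-> /eqP->] [-> ->].
by exists b.
Qed.

Lemma same_weights0l E : same_weights ast circ [::] E. Proof. by move=> ? ? ? ? ? ? ? []. Qed.
Lemma same_weights0r E : same_weights ast circ E [::]. Proof. by move=> ? ? ? ? ? ? ? _ []. Qed.

Lemma local_nil_uniq hs bd Q1 Q2 : local_col ast circ hs (fun=> [::]) bd Q1 ->
  local_col ast circ hs (fun=> [::]) bd Q2 -> {in hs, Q1 =1 Q2}.
Proof.
move=> [h1 _] [h2 _] k kh; have [c1 e1] := h1 k kh; have [c2 e2] := h2 k kh.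
by have [-> _] := word0 c1 e1; have [-> _] := word0 c2 e2.
Qed.

Section R1.
Variables (l : nat) (b s : bool).
Let P0 : nat -> seq occ := fun=> [::].
Let P1 : nat -> seq occ := fun=> [:: (l, b, s); (l, ~~ b, s)].

Lemma local_R1 bd Q : local_col ast circ [:: 0] P1 bd Q ->
  exists x y, [/\ bd 0 = (x, x), Q 0 = xing l b s (x, y) (y, x) & okp b s (x, y) (y, x)].
Proof.
move=> [h v]; have [c e] := h 0 (mem_head _ _); have [m eQ] := word2 c e.
rewrite /= cats0 eQ in v; have /valid_xing o := v.
have [e12 _] := kink HBQ (b := b) o; exists (bd 0).1, m; rewrite eQ -e12 in o *.
by case: (bd 0) e12 o => x y /= ->.
Qed.

Lemma local_R1_unkink : local_embeds ast circ [:: 0] P1 P0.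
Proof.
split=> [bd Q /local_R1[x [y [eb _ _]]]|bd Q1 Q2 /local_R1[x [y [e eQ1 o]]] /local_R1[x' [y' [e' eQ o']]]].
  exists (fun=> [::]); split; last exact: same_weights0r.
  split=> [k|]; last by move=> ? ? ? ? [].
  by rewrite inE => /eqP->; rewrite eb /= eqxx.
move=> k; rewrite inE => /eqP->; rewrite eQ1 eQ; move: e'; rewrite e => -[exx]; subst x'.
by rewrite (kink_inj HBQ o o').
Qed.

Lemma local_R1_kink : local_embeds ast circ [:: 0] P0 P1.
Proof.
split=> [bd Q [h _]|bd Q1 Q2]; last exact: local_nil_uniq.
have [c e] := h 0 (mem_head _ _); have [eQ e12] := word0 c e.
have [y oy] := kink_ex HBQ s b (bd 0).1.
exists (fun=> xing l b s ((bd 0).1, y) (y, (bd 0).1)); split.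
  split=> [k|]; first by rewrite inE => /eqP->; rewrite /= -e12 !eqxx.
  exact/(valid_xing l b s (_, _) (_, _)).
by rewrite /= eQ; apply: same_weights0l.
Qed.
End R1.

Section R2.
Variables (a b : nat) (s same : bool).
Hypothesis ab : a != b.
Let P0 : nat -> seq occ := fun=> [::].
Let P1 : nat -> seq occ := r2_piece a b s same.

Definition r2_over x0 x1 x2 : dword BQ occ :=
  [:: ((a, true, s), (x0, x1)); ((b, true, ~~ s), (x1, x2))].
Definition r2_under y0 y1 y2 : dword BQ occ :=
  if same then [:: ((a, false, s), (y0, y1)); ((b, false, ~~ s), (y1, y2))]
  else [:: ((b, false, ~~ s), (y0, y1)); ((a, false, s), (y1, y2))].

Lemma r2_xings x0 x1 x2 y0 y1 y2 : r2_over x0 x1 x2 ++ r2_under y0 y1 y2 =i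
  xing a true s (x0, x1) (if same then (y0, y1) else (y1, y2)) ++
  xing b true (~~ s) (x1, x2) (if same then (y1, y2) else (y0, y1)).
Proof.
by move=> z; rewrite /r2_over /r2_under /xing; case: same; rewrite /= !inE;
  do 4!case: (z == _).
Qed.

(** The condition at [b] is put through [ok_swap] to have the sign of [a]. Both conditions then
    share their middle colors in the same slots, so [ok_inj] can identify the outer ones. *)
Lemma r2_valid x0 x1 x2 y0 y1 y2 : valid (r2_over x0 x1 x2 ++ r2_under y0 y1 y2) <->
  ok s (if same then (y0, y1) else (y1, y2)) (x0, x1) /\
  ok s (if same then (y2, y1) else (y1, y0)) (x2, x1).
Proof.
set E := _ ++ _; pose F := xing a true s (x0, x1) (if same then (y0, y1) else (y1, y2)) ++
  xing b true (~~ s) (x1, x2) (if same then (y1, y2) else (y0, y1)).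
have -> : valid E <-> valid F by split; apply: eq_valid => z; rewrite r2_xings.
rewrite valid_cat => [|m]; last by rewrite !labels_xing !inE !orbb => /eqP->.
rewrite !valid_xing /okp.
by rewrite -(ok_swap _ _ s (if same then (y2, y1) else (y1, y0))) /swap; case: same.
Qed.

Lemma local_R2 bd Q : local_col ast circ [:: 0; 1] P1 bd Q ->
  exists x0 x1 y0 y1, [/\ bd 0 = (x0, x0) /\ bd 1 = (y0, y0),
   Q 0 = r2_over x0 x1 x0, Q 1 = r2_under y0 y1 y0 &
   ok s (if same then (y0, y1) else (y1, y0)) (x0, x1)].
Proof.
move=> [h v]; have [//|c0 e0] := h 0 _; have [//|c1 e1] := h 1 _.
have [x1 eQ0] := word2 c0 e0.
have [y1 eQ1] : exists y1, Q 1 = r2_under (bd 1).1 y1 (bd 1).2.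
  move: e1; rewrite /P1 /r2_piece /r2_under /=; case: same => e1;
    have [m ->] := word2 c1 e1; by exists m.
rewrite /= cats0 eQ0 eQ1 in v; have [o1 o2] := (r2_valid _ _ _ _ _ _).1 v.
have [ey ex] : (if same then ((bd 1).1, y1) else (y1, (bd 1).2)) =
   (if same then ((bd 1).2, y1) else (y1, (bd 1).1)) /\ ((bd 0).1, x1) = ((bd 0).2, x1).
  by apply: (ok_inj HBQ o1 o2); case: same => /=; auto.
have eb1 : (bd 1).1 = (bd 1).2 by case: same ey => -[].
have eb0 : (bd 0).1 = (bd 0).2 by case: ex.
exists (bd 0).1, x1, (bd 1).1, y1; move: o1; rewrite eQ0 eQ1 -eb1 -eb0.
by split=> //; split; [rewrite {2}eb0|rewrite {2}eb1]; apply: surjective_pairing.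
Qed.

Lemma local_R2_undo : local_embeds ast circ [:: 0; 1] P1 P0.
Proof.
split=> [bd Q /local_R2[x0 [x1 [y0 [y1 [[e0 e1] _ _ _]]]]]|].
  exists (fun=> [::]); split; last exact: same_weights0r.
  split=> [k|]; last by move=> ? ? ? ? [].
  by rewrite !inE => /orP[] /eqP->; rewrite ?e0 ?e1 /= eqxx.
move=> bd Q1 Q2 /local_R2[x0 [x1 [y0 [y1 [[e0 e1] q0 q1 o]]]]].
move=> /local_R2[z0 [z1 [w0 [w1 [[]]]]]]; rewrite e0 e1 => -[? _] [? _]; subst z0 w0.
move=> r0 r1 o'.
have [eu ev] : (if same then (y0, y1) else (y1, y0)) = (if same then (y0, w1) else (w1, y0))
    /\ (x0, x1) = (x0, z1).
  by apply: (ok_inj HBQ o o'); case: same => /=; auto.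
have ey : y1 = w1 by case: same eu => -[].
case: ev => ev; subst z1 w1.
by move=> k; rewrite !inE => /orP[] /eqP->; rewrite ?q0 ?q1 ?r0 ?r1.
Qed.

Lemma local_R2_do : local_embeds ast circ [:: 0; 1] P0 P1.
Proof.
split=> [bd Q [h _]|bd Q1 Q2]; last exact: local_nil_uniq.
have [//|c0 f0] := h 0 _; have [//|c1 f1] := h 1 _.
have [q0 e0] := word0 c0 f0; have [q1 e1] := word0 c1 f1.
(* At [a] the over-strand comes in from outside; the outer end of the under-strand there is its
   incoming one if the directions agree and its outgoing one otherwise. *)
have [[u1 u2] [[v1 v2] [o eu ev]]] := ok_ex HBQ s same true (bd 1).1 (bd 0).1.
pose y1 := if same then u2 else u1.
exists (fun k => if k == 0 then r2_over (bd 0).1 v2 (bd 0).1 else r2_under (bd 1).1 y1 (bd 1).1).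
split.
  split; last first.
    rewrite /= cats0; apply/r2_valid; move: o eu ev; rewrite /y1.
    by case: same => /= o <- <-.
  move=> k; rewrite !inE => /orP[] /eqP-> /=; first by rewrite -e0 !eqxx.
  by rewrite /r2_under /P1 /r2_piece /=; case: same; rewrite /= -e1 !eqxx.
by rewrite /= q0 q1; apply: same_weights0l.
Qed.

Lemma r2_weights bd Q u v u' v' :
  local_col ast circ [:: 0; 1] P1 bd Q ->
  cross (flatten (map Q [:: 0; 1])) a s u v ->
  cross (flatten (map Q [:: 0; 1])) b (~~ s) u' v' -> wt s u v = wt (~~ s) u' v'.
Proof.
move=> /local_R2[x0 [x1 [y0 [y1 [_ q0 q1 _]]]]]; rewrite /= cats0 q0 q1.
move=> /(eq_cross _ _ _ _ (r2_xings _ _ _ _ _ _)) cr.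
move=> /(eq_cross _ _ _ _ (r2_xings _ _ _ _ _ _)) cr'.
have /xing_cross[_ _ [-> ->]] : cross (xing a true s (x0, x1) (if same then (y0, y1) else (y1, y0))) a s u v.
  by apply: cross_catl cr; rewrite labels_xing !inE orbb.
have /xing_cross[_ _ [-> ->]] : cross (xing b true (~~ s) (x1, x0) (if same then (y1, y0) else (y0, y1))) b (~~ s) u' v'.
  by apply: cross_catr cr'; rewrite labels_xing !inE orbb eq_sym.
by rewrite -(wt_swap s); case: same.
Qed.
End R2.

(** Searches the eight side patterns for one whose crossing relations unify with the given ones and
    for which [k] closes the goal. *)
Ltac try_triangle tri HTM HTB HMB k :=
  let go sT sM sB :=
    let t := fresh "t" in let m := fresh "m" in let b := fresh "b" in
    destruct (tri sT sM sB _ _ _ _ _ _ _ _ _ HTM HTB HMB) as [t [m [b [[? ?] [? ?] [? ?]]]]];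
    k t m b in
  first [go true true true | go true true false | go true false true | go true false false
   | go false true true | go false true false | go false false true | go false false false].
Ltac close_with E x y z := exists x, y, z; by split; split=> //; apply/E.

Section R3.

(** For edge [k] with outer colors [x], [y] and triangle color [m], this is the passage through
    vertex [k]; the one through vertex [k-1] is [ends (~~ s)]. *)
Definition ends (s : bool) (x m y : BQ) : col2 := if s then (m, y) else (x, m).

(** The first hypothesis excludes the two cyclic over-under patterns. What remains is six height
    orders times eight orientations, each an instance of [triangle]. *)
Lemma r3_core (s0 s1 s2 c0 c1 c2 : bool) g0 g1 g2 x0 y0 x1 y1 x2 y2 m0 m1 m2 :
  ~~ ((c0 == c1) && (c1 == c2)) ->
  g0 = ((s0 == s1) == c0) -> g1 = ((s1 == s2) == c1) -> g2 = ((s2 == s0) == c2) ->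
  okp c0 g0 (ends s0 x0 m0 y0) (ends (~~ s1) x1 m1 y1) ->
  okp c1 g1 (ends s1 x1 m1 y1) (ends (~~ s2) x2 m2 y2) ->
  okp c2 g2 (ends s2 x2 m2 y2) (ends (~~ s0) x0 m0 y0) ->
  exists n0 n1 n2,
  [/\ okp c0 g0 (ends (~~ s0) x0 n0 y0) (ends s1 x1 n1 y1) /\
      ggen ast circ (wtp c0 g0 (ends s0 x0 m0 y0) (ends (~~ s1) x1 m1 y1)) =
      ggen ast circ (wtp c0 g0 (ends (~~ s0) x0 n0 y0) (ends s1 x1 n1 y1)),
      okp c1 g1 (ends (~~ s1) x1 n1 y1) (ends s2 x2 n2 y2) /\
      ggen ast circ (wtp c1 g1 (ends s1 x1 m1 y1) (ends (~~ s2) x2 m2 y2)) =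
      ggen ast circ (wtp c1 g1 (ends (~~ s1) x1 n1 y1) (ends s2 x2 n2 y2)) &
      okp c2 g2 (ends (~~ s2) x2 n2 y2) (ends s0 x0 n0 y0) /\
      ggen ast circ (wtp c2 g2 (ends s2 x2 m2 y2) (ends (~~ s0) x0 m0 y0)) =
      ggen ast circ (wtp c2 g2 (ends (~~ s2) x2 n2 y2) (ends s0 x0 n0 y0))].
Proof.
have okpE c s p q : okp c s p q <-> if c
  then (if s then side_rel ast circ q.1 p.2 q.2 p.1 else side_rel ast circ q.2 p.1 q.1 p.2)
  else (if s then side_rel ast circ p.1 q.2 p.2 q.1 else side_rel ast circ p.2 q.1 p.1 q.2).
  by case: c; apply: okE.
have tri sT sM sB := @triangle _ _ _ HBQ sT sM sB.
move=> nc -> -> -> /okpE H0 /okpE H1 /okpE H2; move: nc H0 H1 H2.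
case: c0 c1 c2 => [] [] [] // _; case: s0 s1 s2 => [] [] [] H0 H1 H2.
all: rewrite /= in H0 H1 H2.
(* The six alternatives run over the assignments of edges to top, middle and bottom; the
   continuations put the new sides back in edge order. *)
all: first
 [ try_triangle tri H0 H2 H1 ltac:(fun t m b => close_with okpE t m b)
 | try_triangle tri H2 H0 H1 ltac:(fun t m b => close_with okpE t b m)
 | try_triangle tri H0 H1 H2 ltac:(fun t m b => close_with okpE m t b)
 | try_triangle tri H1 H0 H2 ltac:(fun t m b => close_with okpE b t m)
 | try_triangle tri H2 H1 H0 ltac:(fun t m b => close_with okpE m b t)
 | try_triangle tri H1 H2 H0 ltac:(fun t m b => close_with okpE b m t) ].
Qed.


Definition strand (s : bool) (A B : occ) (x m y : BQ) : dword BQ occ :=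
  if s then [:: (A, (x, m)); (B, (m, y))] else [:: (B, (x, m)); (A, (m, y))].

Lemma mem_strand s A B x m y :
  strand s A B x m y =i [:: (A, ends (~~ s) x m y); (B, ends s x m y)].
Proof. by move=> z; case: s; rewrite !inE // orbC. Qed.

Lemma strandP s A B x (E : dword BQ occ) y : chain x E y ->
  unzip1 E = (if s then [:: A; B] else [:: B; A]) -> exists m, E = strand s A B x m y.
Proof. by move=> c; case: s => /(word2 c). Qed.

Lemma chain_strand s A B x m y : chain x (strand s A B x m y) y /\
  unzip1 (strand s A B x m y) = (if s then [:: A; B] else [:: B; A]).
Proof. by case: s; rewrite /= !eqxx. Qed.

Lemma okp_inj c s p q p' q' : okp c s p q -> okp c s p' q' ->
  p.1 = p'.1 \/ p.2 = p'.2 -> q.1 = q'.1 \/ q.2 = q'.2 -> p = p' /\ q = q'.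
Proof. by case: c => o o' h h'; have [] := ok_inj HBQ o o'. Qed.

Lemma ends_or s x m y m' : (ends s x m y).1 = (ends s x m' y).1 \/
  (ends s x m y).2 = (ends s x m' y).2.
Proof. by case: s; [right|left]. Qed.

Lemma ends_inj s x m y m' : ends s x m y = ends s x m' y -> m = m'.
Proof. by case: s => -[]. Qed.

Lemma uniq3 (T : eqType) (x y z : T) : uniq [:: x; y; z] -> [/\ x != y, x != z & y != z].
Proof. by rewrite /= !inE negb_or andbT => /andP[/andP[]]. Qed.

Lemma xing3_wt l0 l1 l2 c0 c1 c2 g0 g1 g2 p0 q0 p1 q1 p2 q2 l s u v :
  uniq [:: l0; l1; l2] ->
  cross (xing l0 c0 g0 p0 q0 ++ xing l1 c1 g1 p1 q1 ++ xing l2 c2 g2 p2 q2) l s u v ->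
  [\/ l = l0 /\ wt s u v = wtp c0 g0 p0 q0, l = l1 /\ wt s u v = wtp c1 g1 p1 q1 |
      l = l2 /\ wt s u v = wtp c2 g2 p2 q2].
Proof.
move=> /uniq3[n01 n02 n12] cr.
have xw l' c g p q : cross (xing l' c g p q) l s u v -> wt s u v = wtp c g p q.
  by move=> /xing_cross[_ -> ]; rewrite /wtp; case: c => -[-> ->].
have : l \in [:: l0; l1; l2].
  have := cross_label cr; rewrite -/(labels _) !labels_cat !labels_xing !mem_cat !inE !orbb.
  by [].
rewrite !inE => /or3P[] /eqP el; subst l.
- apply: Or31; split=> //; apply: (xw l0); apply: cross_catl cr.
  by rewrite labels_cat !labels_xing mem_cat !inE !orbb negb_or n01.
- apply: Or32; split=> //; apply: (xw l1); apply: cross_catl (cross_catr _ cr).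
    by rewrite labels_xing !inE !orbb.
  by rewrite labels_xing !inE !orbb eq_sym.
- apply: Or33; split=> //; apply: (xw l2); apply: cross_catr (cross_catr _ cr).
    by rewrite labels_xing !inE !orbb eq_sym.
  by rewrite labels_xing !inE !orbb eq_sym.
Qed.

Lemma valid_xing3 l0 l1 l2 c0 c1 c2 g0 g1 g2 p0 q0 p1 q1 p2 q2 : uniq [:: l0; l1; l2] ->
  valid (xing l0 c0 g0 p0 q0 ++ xing l1 c1 g1 p1 q1 ++ xing l2 c2 g2 p2 q2) <->
  [/\ okp c0 g0 p0 q0, okp c1 g1 p1 q1 & okp c2 g2 p2 q2].
Proof.
move=> /uniq3[n01 n02 n12].
rewrite !valid_cat ?valid_xing => [|m|m].
- by split=> [[? []]|[]].
- by rewrite !labels_xing !inE !orbb => /eqP->.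
- by rewrite labels_cat !labels_xing mem_cat !inE !orbb => /eqP->; rewrite negb_or n01.
Qed.

Variables (l h : nat -> nat).
Hypothesis ul : uniq [:: l 0; l 1; l 2].
Hypothesis uh : uniq [:: h 0; h 1; h 2].

Let c0 := h 1 < h 0.
Let c1 := h 2 < h 1.
Let c2 := h 0 < h 2.
Let sg (s : nat -> bool) i j (c : bool) := (s i == s j) == c.

(** The last clause holds because the three cyclic comparisons of distinct heights can neither all
    succeed nor all fail. *)
Lemma r3_heights : [/\ (h 0 < h 1) = ~~ c0, (h 1 < h 2) = ~~ c1, (h 2 < h 0) = ~~ c2 &
  ~~ ((c0 == c1) && (c1 == c2))].
Proof.
have [n01 n02 n12] := uniq3 uh; rewrite /c0 /c1 /c2.
by split; lia.
Qed.

(** Regroups the six passages from strands to crossings. *)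
Lemma mem_r3 s x0 m0 y0 x1 m1 y1 x2 m2 y2 :
  strand (s 0) (r3_occ l h s 2 0) (r3_occ l h s 0 0) x0 m0 y0 ++
  strand (s 1) (r3_occ l h s 0 1) (r3_occ l h s 1 1) x1 m1 y1 ++
  strand (s 2) (r3_occ l h s 1 2) (r3_occ l h s 2 2) x2 m2 y2 =i
  xing (l 0) c0 (sg s 0 1 c0) (ends (s 0) x0 m0 y0) (ends (~~ s 1) x1 m1 y1) ++
  xing (l 1) c1 (sg s 1 2 c1) (ends (s 1) x1 m1 y1) (ends (~~ s 2) x2 m2 y2) ++
  xing (l 2) c2 (sg s 2 0 c2) (ends (s 2) x2 m2 y2) (ends (~~ s 0) x0 m0 y0).
Proof.
have [e0 e1 e2 _] := r3_heights.
move=> z; rewrite !mem_cat !mem_strand !inE /r3_occ /= e0 e1 e2 -/c0 -/c1 -/c2 /sg.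
by do 6!case: (z == _).
Qed.

Lemma local_R3P s bd Q : local_col ast circ [:: 0; 1; 2] (r3_before l h s) bd Q <->
  exists m0 m1 m2,
  [/\ [/\ Q 0 = strand (s 0) (r3_occ l h s 2 0) (r3_occ l h s 0 0) (bd 0).1 m0 (bd 0).2,
      Q 1 = strand (s 1) (r3_occ l h s 0 1) (r3_occ l h s 1 1) (bd 1).1 m1 (bd 1).2 &
      Q 2 = strand (s 2) (r3_occ l h s 1 2) (r3_occ l h s 2 2) (bd 2).1 m2 (bd 2).2],
      okp c0 (sg s 0 1 c0) (ends (s 0) (bd 0).1 m0 (bd 0).2) (ends (~~ s 1) (bd 1).1 m1 (bd 1).2),
      okp c1 (sg s 1 2 c1) (ends (s 1) (bd 1).1 m1 (bd 1).2) (ends (~~ s 2) (bd 2).1 m2 (bd 2).2) &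
      okp c2 (sg s 2 0 c2) (ends (s 2) (bd 2).1 m2 (bd 2).2) (ends (~~ s 0) (bd 0).1 m0 (bd 0).2)].
Proof.
split=> [[hQ v]|[m0 [m1 [m2 [[q0 q1 q2] o0 o1 o2]]]]].
  have [//|d0 e0] := hQ 0 _; have [//|d1 e1] := hQ 1 _; have [//|d2 e2] := hQ 2 _.
  have [m0 q0] := strandP d0 e0; have [m1 q1] := strandP d1 e1; have [m2 q2] := strandP d2 e2.
  exists m0, m1, m2; rewrite /= cats0 q0 q1 q2 in v.
  by have /(valid_xing3 _ _ _ _ _ _ _ _ _ _ _ _ ul)[] := eq_valid (mem_r3 _ _ _ _ _ _ _ _ _ _) v.
split=> [k|].
  by rewrite !inE => /or3P[] /eqP->; rewrite ?q0 ?q1 ?q2; apply: chain_strand.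
rewrite /= cats0 q0 q1 q2; apply: (@eq_valid _ _ _ _ _ (fun z => esym (mem_r3 _ _ _ _ _ _ _ _ _ _ z))).
exact/(valid_xing3 _ _ _ _ _ _ _ _ _ _ _ _ ul).
Qed.

Lemma local_R3 s : local_embeds ast circ [:: 0; 1; 2] (r3_before l h s)
  (r3_before l h (fun k => ~~ s k)).
Proof.
pose s' k := ~~ s k.
have sgE i j c : sg s' i j c = sg s i j c by rewrite /sg /s'; case: (s i) (s j) => [] [].
have [_ _ _ nc] := r3_heights.
split=> [bd Q /local_R3P[m0 [m1 [m2 [[q0 q1 q2] o0 o1 o2]]]]|bd Q1 Q2].
  have [n0 [n1 [n2 [[p0 w0] [p1 w1] [p2 w2]]]]] := r3_core nc erefl erefl erefl o0 o1 o2.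
  pose Q' k := if k == 0 then strand (s' 0) (r3_occ l h s' 2 0) (r3_occ l h s' 0 0) (bd 0).1 n0 (bd 0).2
    else if k == 1 then strand (s' 1) (r3_occ l h s' 0 1) (r3_occ l h s' 1 1) (bd 1).1 n1 (bd 1).2
    else strand (s' 2) (r3_occ l h s' 1 2) (r3_occ l h s' 2 2) (bd 2).1 n2 (bd 2).2.
  exists Q'; split.
    by apply/local_R3P; exists n0, n1, n2; rewrite !sgE /s' !negbK.
  move=> m t u v t' u' v'; rewrite /= !cats0 q0 q1 q2.
  move=> /(eq_cross _ _ _ _ (mem_r3 _ _ _ _ _ _ _ _ _ _))/(xing3_wt ul) wE.
  move=> /(eq_cross _ _ _ _ (mem_r3 _ _ _ _ _ _ _ _ _ _))/(xing3_wt ul) wE'.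
  have [n01 n02 n12] := uniq3 ul.
  rewrite !sgE /s' !negbK in wE'.
  by case: wE => -[em ->]; case: wE' => -[em' ->] //; move: n01 n02 n12;
    rewrite -em -em' eqxx.
move=> /local_R3P[m0 [m1 [m2 [[q0 q1 q2] o0 o1 o2]]]] /local_R3P[n0 [n1 [n2 [[r0 r1 r2] p0 p1 p2]]]].
(* Two fillings agree in one outer color on each strand at every vertex. Vertex 0 then determines
   the colors of edges 0 and 1, and vertex 1 that of edge 2. *)
have [/ends_inj e0 /ends_inj e1] := okp_inj o0 p0 (ends_or _ _ _ _ _) (ends_or _ _ _ _ _).
have [_ /ends_inj e2] := okp_inj o1 p1 (ends_or _ _ _ _ _) (ends_or _ _ _ _ _).
by subst n0 n1 n2; move=> k; rewrite !inE => /or3P[] /eqP->; rewrite ?q0 ?q1 ?q2.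
Qed.

End R3.
End Moves.

(** * Change of base points and of the order of components *)

Section Reindexing.
Variables (BQ : finType) (ast circ : BQ -> BQ -> BQ).

(** Moving the base point replaces the base color by the incoming color of the new first passage; an
    empty word keeps its color. *)
Definition rot_comp (T : Type) k (c : BQ * dword BQ T) : BQ * dword BQ T :=
  (if rot k c.2 is i :: _ then i.2.1 else c.1, rot k c.2).

Lemma chain_start (T : Type) x (E : dword BQ T) y :
  chain x E y -> (if E is i :: _ then i.2.1 else y) = x.
Proof. by case: E => [/eqP|[t [a b]] E /= /andP[/eqP]]. Qed.

Lemma chain_rot (T : Type) k (c : BQ * dword BQ T) : chain c.1 c.2 c.1 ->
  chain (rot_comp k c).1 (rot_comp k c).2 (rot_comp k c).1.
Proof.
rewrite -{1}(cat_take_drop k c.2) /rot_comp /= => /chain_cat[z c1 c2].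
have cz : chain z (rot k c.2) z by apply/chain_cat; exists c.1.
have <- : z = if rot k c.2 is i :: _ then i.2.1 else c.1; last by [].
have := chain_start cz; case eR : (rot k c.2) => // _.
have e0 : c.2 = [::] by apply: size0nil; rewrite -(size_rot k) eR.
by move: c1; rewrite e0 /= => /eqP.
Qed.

Lemma rot_comp_inj (T : Type) k (c d : BQ * dword BQ T) : chain c.1 c.2 c.1 -> chain d.1 d.2 d.1 ->
  rot_comp k c = rot_comp k d -> c = d.
Proof.
case: c d => [x E] [y F] /= cE cF [e /rot_inj eEF]; subst F; congr (_, _).
have := chain_start cE; have := chain_start cF; move: e.
by case: E {cE cF} => [|i E] //= _ -> ->.
Qed.

Lemma arcs_weights (D : diagram) (X X' : cdiag BQ occ) l s u v s' u' v' :
  good (flatten D) -> erase X = D -> arcs X' =i arcs X ->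
  cross (arcs X) l s u v -> cross (arcs X') l s' u' v' ->
  ggen ast circ (wt s u v) = ggen ast circ (wt s' u' v').
Proof.
move=> gD eX eA cr /(eq_cross _ _ _ _ eA) cr'.
by rewrite -eX -arcs_erase in gD; have [-> -> ->] := cross_fun gD cr cr'.
Qed.

Lemma rot_embeds (D : diagram) ks : good (flatten D) -> size ks = size D ->
  embeds ast circ D [seq rot k.1 k.2 | k <- zip ks D].
Proof.
move=> gD sz; pose f (X : cdiag BQ occ) := [seq rot_comp k.1 k.2 | k <- zip ks X].
have arcsf X : size ks = size X -> arcs (f X) =i arcs X.
  move=> szX; apply: perm_mem; rewrite /arcs /f.
  elim: (ks) X szX => [|k r IH] [|c X] //= [/IH h]; apply: perm_cat => //.
  by rewrite perm_rot.
exists (fun X X' => X' = f X); split.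
- move=> X [eX cX vX]; exists (f X) => //.
  have szX : size ks = size X by rewrite sz -eX size_map.
  split; last by apply: eq_valid vX => z; rewrite arcsf.
    rewrite -eX /f /erase; elim: (ks) (X) => [|k r IH] [|c Z] //=.
    by rewrite IH /unzip1 map_rot.
  rewrite /f; elim: (ks) (X) cX => [|k r IH] [|c Z] //= /andP[cc cZ].
  by rewrite chain_rot // IH.
- move=> X Y X' [eX cX _] [eY cY _] _ -> exy.
  have szX : size X = size ks by rewrite sz -eX size_map.
  have szY : size Y = size ks by rewrite sz -eY size_map.
  move: exy; rewrite /f; elim: (ks) (X) (Y) szX szY cX cY => [|k r IH] [|c Z] [|d W] //= [sZ] [sW].
  move=> /andP[cc cZ] /andP[cd cW] [e1 e2 e3]; rewrite (IH Z W) //.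
  by rewrite (@rot_comp_inj _ k c d) //; congr (_, _).
- move=> X X' [eX cX vX] _ -> l s u v s' u' v' cr cr'.
  apply: (arcs_weights gD eX _ cr cr').
  by apply: arcsf; rewrite sz -eX size_map.
Qed.

Lemma onth_some (T : Type) (x : T) (r : seq T) i : i < size r -> onth r i = Some (nth x r i).
Proof. by move=> ir; rewrite onthE (nth_map x). Qed.

(** One list of indices [Is] reorders all colorings. Reading through [onth] avoids a default color,
    which an empty [BQ] could not supply; injectivity holds as [Is] runs through all indices. *)
Lemma perm_embeds (D D' : diagram) : good (flatten D) -> perm_eq D' D -> embeds ast circ D D'.
Proof.
move=> gD /(perm_iotaP [::])[Is pIs eD'].
have szI i : (i \in Is) = (i < size D) by rewrite (perm_mem pIs) mem_iota.
pose R (X X' : cdiag BQ occ) := map some X' = map (onth X) Is.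
have RE X X' c : size X = size D -> R X X' -> X' = map (nth c X) Is.
  move=> sX eXX; apply: (inj_map (@Some_inj _)); rewrite eXX -map_comp.
  by apply/eq_in_map => i; rewrite szI -sX => iX; apply: onth_some.
have sizeX (X : cdiag BQ occ) : erase X = D -> size X = size D by move=> <-; rewrite size_map.
have RP (X X' : cdiag BQ occ) (c : BQ * dword BQ occ) : size X = size D -> R X X' -> perm_eq X' X.
  move=> sX RX; apply: (introT (perm_iotaP c)); exists Is; [by rewrite sX | exact: RE].
have RA X X' : erase X = D -> R X X' -> arcs X' =i arcs X.
  move=> eX RX; apply: perm_mem; apply: perm_flatten; apply: perm_map.
  case: X eX RX => [|c X] eX RX; last by apply: (RP _ _ c) => //; apply: sizeX.
  have : Is = [::] by apply: size0nil; rewrite (perm_size pIs) size_iota -eX.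
  by move: RX; rewrite /R => + e; rewrite e; case: (X').
exists R; split.
- move=> X [eX cX vX]; have sX := sizeX _ eX.
  have [X' RX] : exists X', R X X'.
    case: X {eX cX vX} sX => [|c X] sX.
      exists [::]; rewrite /R; have -> // : Is = [::].
      by apply: size0nil; rewrite (perm_size pIs) size_iota -sX.
    exists (map (nth c (c :: X)) Is); rewrite /R -map_comp; apply/eq_in_map => i.
    by rewrite szI -sX => iX; rewrite /= (onth_some c).
  exists X' => //; split; last by apply: eq_valid vX => z; rewrite (RA X).
    rewrite eD' -eX; case: X eX cX vX sX RX => [|c X] eX cX vX sX RX.
      have e0 : Is = [::] by apply: size0nil; rewrite (perm_size pIs) size_iota -sX.
      by move: RX; rewrite /R e0; case: (X').
    rewrite (RE _ _ c sX RX) /erase -map_comp; apply/eq_in_map => i.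
    by rewrite szI -sX => iX; rewrite (nth_map c).
  case: X eX cX vX sX RX => [|c X] eX cX vX sX RX.
    have e0 : Is = [::] by apply: size0nil; rewrite (perm_size pIs) size_iota -sX.
    by move: RX; rewrite /R e0; case: (X').
  by rewrite /closed (perm_all _ (RP _ _ c sX RX)).
- move=> X Y X' [eX _ _] [eY _ _] _ RX RY.
  have sX := sizeX _ eX; have sY := sizeX _ eY.
  case: X eX RX sX => [|c X] eX RX sX.
    by case: Y sY {eY RY}; rewrite -sX.
  apply: (@eq_from_nth _ c) => [|i iX]; first by rewrite sX.
  have iI : i \in Is by rewrite szI -sX.
  have /eq_in_map h : map (nth c (c :: X)) Is = map (nth c Y) Is by rewrite -(RE _ _ c sX RX) (RE _ _ c sY RY).
  exact: h.
- move=> X X' [eX _ _] _ RX l s u v s' u' v' cr cr'.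
  by apply: (arcs_weights gD eX _ cr cr'); apply: RA.
Qed.

End Reindexing.

(** * Well-formedness and crossings of filled contexts, and relabelling *)

Lemma good_perm s s' : perm_eq s s' -> good s -> good s'.
Proof.
move=> ss' [us g]; split; first by rewrite -(perm_uniq ss').
by move=> l b e b' e'; rewrite -!(perm_mem ss'); apply: g.
Qed.

Lemma good_cat s1 s2 : (forall l, l \in map olabel s1 -> l \notin map olabel s2) ->
  good (s1 ++ s2) <-> good s1 /\ good s2.
Proof.
move=> dis.
have d1 l b e : (l, b, e) \in s1 -> forall b' e', (l, b', e') \in s2 = false.
  move=> o1 b' e'; apply/negP => o2; have /dis/negP : l \in map olabel s1.
    by apply/mapP; exists (l, b, e).
  by apply; apply/mapP; exists (l, b', e').
have d2 l b e : (l, b, e) \in s2 -> forall b' e', (l, b', e') \in s1 = false.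
  by move=> o2 b' e'; apply/negP => /d1 /(_ b e); rewrite o2.
split=> [[u g]|[[u1 g1] [u2 g2]]].
  move: u; rewrite cat_uniq => /and3P[u1 _ u2]; split; split=> // l b e b' e' o.
    by rewrite -(g l b e b' e') ?mem_cat ?o // (d1 _ _ _ o) orbF.
  by rewrite -(g l b e b' e') ?mem_cat ?o ?orbT // (d2 _ _ _ o).
split; first rewrite cat_uniq u1 u2 andbT.
  by apply/hasPn => -[[l b] e] /d2 ->.
move=> l b e b' e'; rewrite !mem_cat => /orP[] o; rewrite ?(d1 _ _ _ o) ?(d2 _ _ _ o).
  by rewrite orbF; apply: g1 o.
exact: g2 o.
Qed.

Lemma good_pair l b s : good [:: (l, b, s); (l, ~~ b, s)].
Proof.
split=> [|l' c e c' e']; first by rewrite /= inE !xpair_eqE; case: b; rewrite andbF.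
rewrite !inE !xpair_eqE; case: (l' == l) => //=.
by case: b c c' => [] [] [] /=; rewrite ?orbF => /eqP->.
Qed.

Lemma good_fill C hs P : perm_eq (holes C) hs ->
  good (flatten (fill C P)) <-> good (inls (flatten C) ++ flatten (map P hs)).
Proof.
move=> pC; have p : perm_eq (flatten (fill C P)) (inls (flatten C) ++ flatten (map P hs)).
  apply: perm_trans (flatten_fill_perm _ _) _; rewrite perm_cat2l.
  by apply: perm_flatten; apply: perm_map.
by split; apply: good_perm => //; rewrite perm_sym.
Qed.

Lemma crossings_fill C hs P l : perm_eq (holes C) hs ->
  (l \in crossings (fill C P)) = (l \in ctx_labels C) || (l \in map olabel (flatten (map P hs))).
Proof.
move=> pC; rewrite mem_crossings -mem_cat ctx_labelsE -map_cat; apply: perm_mem; apply: perm_map.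
apply: perm_trans (flatten_fill_perm _ _) _; rewrite perm_cat2l.
by apply: perm_flatten; apply: perm_map.
Qed.

Section Relabel.
Variables (r : nat -> nat) (r_inj : injective r).

Definition rl (o : occ) : occ := (r (olabel o), oover o, opos o).

Lemma rl_inj : injective rl.
Proof. by move=> [[l b] e] [[l' b'] e']; rewrite /rl /olabel /oover /opos /= => -[/r_inj-> -> ->]. Qed.

Lemma good_rl s : good (map rl s) <-> good s.
Proof.
rewrite /good (map_inj_uniq rl_inj).
have m l b e : ((r l, b, e) \in map rl s) = ((l, b, e) \in s) by rewrite (mem_map rl_inj _ (l, b, e)).
split=> -[us g]; split=> // l b e b' e'; first by rewrite -!m; apply: g.
by move=> /mapP[[[l0 b0] e0] o]; rewrite /rl /olabel /oover /opos /= => -[-> _ ->]; rewrite m; apply: g o.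
Qed.

Variables (BQ : finType) (ast circ : BQ -> BQ -> BQ) (D : diagram).
Let D' : diagram := map (map rl) D.

Lemma flatten_rl : flatten D' = map rl (flatten D).
Proof. by rewrite map_flatten. Qed.

Lemma crossings_rl : crossings D' = map r (crossings D).
Proof.
rewrite /crossings flatten_rl -map_comp -(undup_map_inj r_inj) -map_comp.
by [].
Qed.

Lemma csign_rl l : csign D' (r l) = csign D l.
Proof.
rewrite /csign flatten_rl find_map.
have -> : find (preim rl (fun o => olabel o == r l)) (flatten D) =
    find (fun o => olabel o == l) (flatten D).
  by apply: eq_find => o /=; rewrite /olabel /= (inj_eq r_inj).
elim: (flatten D) (find _ _) => [|o s IH] [|i] //=; exact: IH.
Qed.

Lemma nth_rl i : nth [::] D' i = map rl (nth [::] D i).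
Proof. by rewrite /D'; elim: D i => [|w W IH] [|i] /=. Qed.

Lemma ccomp_rl o : ccomp D' (rl o) = ccomp D o.
Proof.
rewrite /ccomp find_map; apply: eq_find => w /=; exact: mem_map rl_inj _ _.
Qed.

Lemma cross_cols_rl (cs : seq (seq BQ)) l : cross_cols D' cs (r l) = cross_cols D cs l.
Proof.
have io o : in_col D' cs (rl o) = in_col D cs o /\ out_col D' cs (rl o) = out_col D cs o.
  rewrite /in_col /out_col /cpos ccomp_rl nth_rl size_map index_map //; exact: rl_inj.
rewrite /cross_cols csign_rl.
have [i1 o1] := io (l, false, csign D l); have [i2 o2] := io (l, true, csign D l).
by rewrite -i1 -o1 -i2 -o2.
Qed.

(** Colors are stored by position, so relabelling leaves the list of colorings literally the same
    and no embeddings are needed. *)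
Lemma colorings_rl : colorings ast circ D' = colorings ast circ D.
Proof.
rewrite /colorings.
have -> : [seq maxn (size c) 1 | c <- D'] = [seq maxn (size c) 1 | c <- D].
  by rewrite -map_comp; apply: eq_map => w /=; rewrite size_map.
apply: eq_filter => cs; rewrite crossings_rl all_map; apply: eq_all => l /=.
by rewrite /cross_ok cross_cols_rl csign_rl.
Qed.

Lemma cindex_rl l : @cindex BQ ast circ D' (r l) = @cindex BQ ast circ D l.
Proof.
apply: functional_extensionality => h; rewrite /cindex colorings_rl.
by apply: eq_bigr => cs _; rewrite /cweight cross_cols_rl csign_rl.
Qed.

End Relabel.

(** * Invariance of the coefficients under each move *)

Section Invariance.
Variables (BQ : finType) (ast circ : BQ -> BQ -> BQ) (g : ZG ast circ).
Hypothesis HBQ : biquandle ast circ.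
Local Notation cindex := (@cindex BQ ast circ).
Local Notation colorings := (colorings ast circ).
Local Notation term D l := (if pbool (cindex D l = proj1_sig g) then writhe_c D l else 0)%R.

(** Bookkeeping common to all moves: persisting crossings contribute equally, and the last
    hypothesis says that the new ones contribute just the change of the writhe correction. *)
Lemma a_g_eq D D' r new : perm_eq (crossings D') (new ++ map r (crossings D)) ->
  (forall l, l \in crossings D ->
    cindex D' (r l) = cindex D l /\ writhe_c D' (r l) = writhe_c D l) ->
  size (colorings D) = size (colorings D') ->
  (\sum_(l <- new) term D' l =
   if pbool (proj1_sig g = @Ne BQ ast circ D') then \sum_(l <- new) writhe_c D' l else 0)%R ->
  a_g g D = a_g g D'.
Proof.
move=> pc same sz new0; rewrite /a_g.
have eN : @Ne BQ ast circ D = @Ne BQ ast circ D'.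
  by apply: functional_extensionality => h; rewrite /Ne sz.
have ew : (writhe D' = \sum_(l <- new) writhe_c D' l + writhe D)%R.
  rewrite /writhe (perm_big _ pc) big_cat big_map; congr (_ + _)%R.
  by apply: eq_big_seq => l /same[].
rewrite (perm_big _ pc) big_cat big_map /= new0 eN ew.
have -> : (\sum_(l <- crossings D) term D' (r l) = \sum_(l <- crossings D) term D l)%R.
  by apply: eq_big_seq => l /same[-> ->].
case: pboolP => _; last by rewrite !GRing.subr0 GRing.add0r.
by rewrite GRing.opprD GRing.addrACA GRing.subrr GRing.add0r.
Qed.

Lemma a_g_same D D' : good (flatten D) -> good (flatten D') -> flatten D =i flatten D' ->
  embeds ast circ D D' -> embeds ast circ D' D -> a_g g D = a_g g D'.
Proof.
move=> gD gD' eD emb emb'; have [sz ind] := embeds_index gD gD' emb emb'.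
have ec l : (l \in crossings D) = (l \in crossings D').
  by rewrite !mem_crossings; apply: eq_mem_map.
apply: (@a_g_eq D D' id [::]) => //.
- by rewrite map_id; apply: uniq_perm; rewrite ?undup_uniq // => l; rewrite ec.
- move=> l lD; split; first by rewrite ind // -ec.
  move: lD; rewrite mem_crossings => /mapP[[[l' b] s] o ->]; rewrite /writhe_c.
  by rewrite (csignE gD o) (csignE (b := b) (s := s) gD') // -eD.
- by rewrite !big_nil; case: ifP.
Qed.

Lemma a_g_new C hs P P' new : perm_eq (holes C) hs -> uniq hs -> hs != [::] ->
  (forall k, P k = [::]) -> fresh C hs P' ->
  good (flatten (fill C P)) -> good (flatten (fill C P')) ->
  local_embeds ast circ hs P P' -> local_embeds ast circ hs P' P ->
  uniq new -> new =i map olabel (flatten (map P' hs)) ->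
  (\sum_(l <- new) term (fill C P') l =
   if pbool (proj1_sig g = @Ne BQ ast circ (fill C P'))
   then \sum_(l <- new) writhe_c (fill C P') l else 0)%R ->
  a_g g (fill C P) = a_g g (fill C P').
Proof.
move=> pC uhs hs0 P0 fr gD gD' le le' un en new0.
have fr0 : fresh C hs P by move=> k l _; rewrite P0.
have eP : flatten (map P hs) = [::] by elim: (hs) => //= k r ->; rewrite P0.
have cP l : (l \in crossings (fill C P)) = (l \in ctx_labels C).
  by rewrite (crossings_fill _ _ pC) eP orbF.
have cP' l : (l \in crossings (fill C P')) = (l \in ctx_labels C) || (l \in new).
  by rewrite (crossings_fill _ _ pC) en.
have emb := fill_embeds pC uhs hs0 fr0 fr gD le.
have emb' := fill_embeds pC uhs hs0 fr fr0 gD' le'.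
have [sz ind] := embeds_index gD gD' emb emb'.
have dis l : l \in new -> l \notin ctx_labels C.
  rewrite en map_flatten -map_comp => /flattenP[w /mapP[k kh ->]].
  exact: fr kh.
have sub : {subset flatten (fill C P) <= flatten (fill C P')}.
  move=> o; rewrite !(perm_mem (flatten_fill_perm _ _)) !mem_cat => /orP[->//|].
  move=> /flattenP[w /mapP[k _ ->]]; by rewrite P0.
apply: (@a_g_eq _ _ id new) => //.
- rewrite map_id; apply: uniq_perm; first exact: undup_uniq.
    rewrite cat_uniq un undup_uniq andbT; apply/hasPn => l; rewrite cP => lC.
    by apply/negP => /dis; rewrite lC.
  by move=> l; rewrite mem_cat cP cP' orbC.
- move=> l lD; split; first by rewrite ind // cP' -cP lD.
  move: lD; rewrite mem_crossings => /mapP[[[l' b] s] o ->]; rewrite /writhe_c.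
  by rewrite (csignE gD o) (csignE (b := b) (s := s) gD') // sub.
Qed.

Lemma wclassE D X l s u v : good (flatten D) -> col ast circ D X -> cross (arcs X) l s u v ->
  wclass ast circ D (to_cs X) l = Some (ggen ast circ (wt s u v)).
Proof.
move=> gD [eX cX _] cr; subst D.
by rewrite /wclass (cross_colsE ast circ gD cX cr).2.
Qed.

Lemma a_g_R1 C l b s : holes C = [:: 0] -> l \notin ctx_labels C ->
  let D := fill C (fun=> [::]) in
  let D' := fill C (fun=> [:: (l, b, s); (l, ~~ b, s)]) in
  (good (flatten D) <-> good (flatten D')) /\ (good (flatten D) -> a_g g D = a_g g D').
Proof.
move=> hC lC D D'; have pC : perm_eq (holes C) [:: 0] by rewrite hC.
have gg : good (flatten D) <-> good (flatten D').
  rewrite !(good_fill _ pC) /= cats0 good_cat; first by have := good_pair l b s; tauto.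
  by move=> m mC; rewrite !inE orbb; apply: contraNneq lC => em; have <- : m = l by [].
split=> // gD; have gD' := gg.1 gD.
have fr : fresh C [:: 0] (fun=> [:: (l, b, s); (l, ~~ b, s)]).
  by move=> k m _; rewrite !inE orbb => /eqP->.
have lD' : l \in crossings D' by rewrite (crossings_fill _ _ pC) inE eqxx orbT.
apply: (a_g_new (new := [:: l]) pC _ _ _ fr gD gD') => //; try exact: local_R1_kink; try exact: local_R1_unkink.
  by move=> m; rewrite !inE orbb.
rewrite !big_seq1.
have -> : cindex D' l = @Ne BQ ast circ D'.
  apply: functional_extensionality => h; rewrite cindexE /Ne.
  have wl cs : cs \in colorings D' -> wclass ast circ D' cs l = Some (gunit ast circ).
    move=> /(coloringsP _ _ _ gD')[X cX <-]; case: (cX) => eX _ _.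
    have [t [u [v cr]]] : exists s u v, cross (arcs X) l s u v by apply: cross_ex; rewrite eX.
    rewrite (wclassE gD' cX cr); have [bd [Q [lQ loc]]] := cross_fill pC isT isT fr cX.
    have [x [y [_ q0 o]]] := local_R1 HBQ lQ.
    have := loc _ _ _ _ lC cr; rewrite /= cats0 q0 => /xing_cross[_ -> uv].
    have [_ [z ez]] := kink HBQ (b := b) o; rewrite -(ggen_diag ast circ z) -ez.
    by move: uv; case: (b) => -[-> ->].
  have -> : count (fun cs => pbool (wclass ast circ D' cs l = Some h)) (colorings D') =
      count (fun=> pbool (h = gunit ast circ)) (colorings D').
    apply: eq_in_count => cs /wl ->; apply: pbool_iff; split=> [[]|->] //.
  case: pboolP => _; first by rewrite count_predT.
  by rewrite count_pred0.
have -> // : pbool (@Ne BQ ast circ D' = proj1_sig g) = pbool (proj1_sig g = @Ne BQ ast circ D').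
by apply: pbool_iff; split=> ->.
Qed.

Lemma a_g_R2 C a b s same : perm_eq (holes C) [:: 0; 1] -> a != b ->
  a \notin ctx_labels C -> b \notin ctx_labels C ->
  let D := fill C (fun=> [::]) in let D' := fill C (r2_piece a b s same) in
  (good (flatten D) <-> good (flatten D')) /\ (good (flatten D) -> a_g g D = a_g g D').
Proof.
move=> pC ab aC bC D D'.
pose w := [:: (a, true, s); (a, false, s)] ++ [:: (b, true, ~~ s); (b, false, ~~ s)].
(* Lists the four passages by crossing instead of by strand, so that [good_pair] applies. *)
have pw : perm_eq (flatten (map (r2_piece a b s same) [:: 0; 1])) w.
  rewrite /r2_piece /w /= ?cats0; case: (same); rewrite /= perm_cons.
    by rewrite (perm_catCA [:: _] [:: _]).
  by rewrite (permEl (perm_catC [:: _; _] [:: _])).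
have gw : good w.
  apply/good_cat; last by split; apply: good_pair.
  by move=> m; rewrite !inE !orbb => /eqP->.
have gg : good (flatten D) <-> good (flatten D').
  rewrite !(good_fill _ pC) cats0.
  have -> : good (inls (flatten C) ++ flatten (map (r2_piece a b s same) [:: 0; 1])) <->
      good (inls (flatten C) ++ w).
    by split; apply: good_perm; rewrite perm_cat2l // perm_sym.
  rewrite good_cat; first by tauto.
  by move=> m mC; rewrite !inE /olabel /=; apply/negP => /or4P[] /eqP em; move: aC bC; rewrite -em ctx_labelsE mC.
split=> // gD; have gD' := gg.1 gD.
have fr : fresh C [:: 0; 1] (r2_piece a b s same).
  move=> k m kh mk; have : m \in map olabel w.
    rewrite -(perm_mem (perm_map olabel pw)) map_flatten -map_comp.
    by apply/flattenP; exists (map olabel (r2_piece a b s same k)) => //; apply/mapP; exists k.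
  by rewrite !inE => /or4P[] /eqP->.
have enw : [:: a; b] =i map olabel (flatten (map (r2_piece a b s same) [:: 0; 1])).
  by move=> m; rewrite (perm_mem (perm_map olabel pw)) !inE; case: (m == a); case: (m == b).
have aD' : a \in crossings D' by rewrite (crossings_fill _ _ pC) -enw mem_head orbT.
have bD' : b \in crossings D' by rewrite (crossings_fill _ _ pC) -enw !inE eqxx !orbT.
apply: (a_g_new (new := [:: a; b]) pC _ _ _ fr gD gD') => //; try exact: local_R2_do; try exact: local_R2_undo.
  by rewrite /= inE ab.
have sE m e t : (m, e, t) \in w -> csign D' m = t.
  move=> mw; apply: (csignE (b := e) gD').
  rewrite (perm_mem (flatten_fill_perm _ _)) mem_cat.
  by rewrite (perm_mem (perm_flatten (perm_map _ pC))) (perm_mem pw) mw orbT.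
have sa : csign D' a = s by apply: (sE a true); rewrite !inE eqxx.
have sb : csign D' b = ~~ s by apply: (sE b true); rewrite !inE eqxx !orbT.
have eab : cindex D' a = cindex D' b.
  apply: functional_extensionality => h; rewrite !cindexE; congr Posz.
  apply: eq_in_count => cs /(coloringsP _ _ _ gD')[X cX <-]; case: (cX) => eX _ _.
  have [t [u [v cr]]] : exists s u v, cross (arcs X) a s u v by apply: cross_ex; rewrite eX.
  have [t' [u' [v' cr']]] : exists s u v, cross (arcs X) b s u v by apply: cross_ex; rewrite eX.
  rewrite (wclassE gD' cX cr) (wclassE gD' cX cr').
  have [bd [Q [lQ loc]]] := cross_fill pC isT isT fr cX.
  have et : t = s.
    by rewrite -sa; symmetry; apply: (csignE (b := false) gD'); rewrite -eX -arcs_erase; apply: unzip1_mem cr.1.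
  have et' : t' = ~~ s.
    by rewrite -sb; symmetry; apply: (csignE (b := false) gD'); rewrite -eX -arcs_erase; apply: unzip1_mem cr'.1.
  subst t t'; rewrite (r2_weights HBQ ab lQ (loc _ _ _ _ aC cr) (loc _ _ _ _ bC cr')) //.
have wab : (writhe_c D' a + writhe_c D' b = 0)%R by rewrite /writhe_c sa sb; case: (s).
rewrite !big_cons !big_nil !GRing.addr0 eab wab.
by case: (pbool (cindex D' b = _)); rewrite ?wab ?GRing.addr0 if_same.
Qed.

(** Reversing all three edges reverses the order of vertices along each, while signs see only
    whether two orientations agree. Thus a single local statement, used for [s] and for its
    negation, gives both embeddings. *)
Lemma r3_afterE l h s : r3_after l h s = r3_before l h (fun k => ~~ s k).
Proof.
apply: functional_extensionality => k; rewrite /r3_after /r3_before.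
have flip i j : r3_occ l h (fun k => ~~ s k) i j = r3_occ l h s i j.
  by rewrite /r3_occ; case: (s i) (s (i.+1 %% 3)) => [] [].
by rewrite !flip; case: (s k).
Qed.

Lemma a_g_R3 C l h s : perm_eq (holes C) [:: 0; 1; 2] ->
  uniq [:: l 0; l 1; l 2] -> uniq [:: h 0; h 1; h 2] ->
  all (fun j => l j \notin ctx_labels C) [:: 0; 1; 2] ->
  let D := fill C (r3_before l h s) in let D' := fill C (r3_after l h s) in
  (good (flatten D) <-> good (flatten D')) /\ (good (flatten D) -> a_g g D = a_g g D').
Proof.
move=> pC ul uh lC D D'.
have pf : perm_eq (flatten D) (flatten D').
  apply: perm_trans (flatten_fill_perm _ _) _; rewrite perm_sym.
  apply: perm_trans (flatten_fill_perm _ _) _; rewrite perm_cat2l.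
  elim: (holes C) => //= k r IH; apply: perm_cat => //.
  by rewrite /r3_after perm_rev.
have gg : good (flatten D) <-> good (flatten D').
  by split; apply: good_perm => //; rewrite perm_sym.
split=> // gD; have gD' := gg.1 gD.
have fr t : fresh C [:: 0; 1; 2] (r3_before l h t).
  case/and4P: lC => l0 l1 l2 _ k m; rewrite !inE => /or3P[] /eqP->;
  by rewrite /r3_before; case: (t _); rewrite !inE => /orP[] /eqP->.
apply: a_g_same => //; first exact: perm_mem.
  rewrite /D' r3_afterE; apply: (fill_embeds pC) => //.
  exact: local_R3.
rewrite /D' r3_afterE; apply: (fill_embeds pC) => //; first by rewrite -r3_afterE.
have := local_R3 HBQ ul uh (fun k => ~~ s k).
have -> // : (fun k => ~~ ~~ s k) = s.
by apply: functional_extensionality => k; rewrite negbK.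
Qed.

(** The equivalence of well-formedness is what lets the induction over chains of moves use a step
    backwards or start in the middle of a chain. *)
Lemma a_g_move D D' : vmove D D' ->
  (good (flatten D) <-> good (flatten D')) /\ (good (flatten D) -> a_g g D = a_g g D').
Proof.
case=> {D D'}.
- move=> D r r_inj; split; first by rewrite (flatten_rl r D) good_rl.
  move=> _; apply: (@a_g_eq _ _ r [::]); rewrite ?big_nil.
  + by rewrite (crossings_rl r_inj D).
  + by move=> l _; rewrite /writhe_c (csign_rl r_inj D) (cindex_rl r_inj ast circ D).
  + by rewrite (colorings_rl r_inj ast circ D).
  + by case: ifP.
- move=> D ks sz; set D' := map _ _.
  have pf : perm_eq (flatten D) (flatten D').
    rewrite /D'; elim: (ks) (D) sz => [|k r IH] [|c W] //= [/IH h].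
    by apply: perm_cat => //; rewrite perm_sym perm_rot.
  have gg : good (flatten D) <-> good (flatten D').
    by split; apply: good_perm => //; rewrite perm_sym.
  split=> // gD; have gD' := gg.1 gD.
  apply: a_g_same => //; [exact: perm_mem | exact: rot_embeds |].
  (* The inverse rotations. An amount beyond the length rotates trivially, and truncated subtraction
     then gives 0. *)
  pose ks' := [seq size k.2 - k.1 | k <- zip ks D].
  have -> : D = [seq rot k.1 k.2 | k <- zip ks' D'].
    rewrite /ks' /D'; elim: (ks) (D) sz => [|k r IH] [|c W] //= [/IH <-].
    congr (_ :: _); case: (leqP k (size c)) => kc; first by rewrite -(size_rot k) -/(rotr _ _) rotK.
    rewrite (rot_oversize (ltnW kc)) (_ : size c - k = 0) ?rot0 //.
    by apply/eqP; rewrite subn_eq0 ltnW.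
  apply: rot_embeds => //.
  by rewrite /ks' /D' !size_map.
- move=> D D' pD; have pf : perm_eq (flatten D) (flatten D') by apply: perm_flatten.
  have gg : good (flatten D) <-> good (flatten D').
    by split; apply: good_perm => //; rewrite perm_sym.
  split=> // gD; have gD' := gg.1 gD.
  by apply: a_g_same => //; [exact: perm_mem | apply: perm_embeds; rewrite // perm_sym | exact: perm_embeds].
- move=> C l b s; exact: a_g_R1.
- move=> C a b s same; exact: a_g_R2.
- move=> C l h s; exact: a_g_R3.
Qed.

End Invariance.

Theorem theorem6p3 (BQ : finType) (ast circ : BQ -> BQ -> BQ)
  (HBQ : biquandle ast circ) (g : ZG ast circ) (L L' : diagram) :
  wf_diagram L -> virt_equiv L L' -> a_g g L = a_g g L'.
Proof.
move=> /wf_diagramP gL LL'.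
suff [_ h] : (good (flatten L) <-> good (flatten L')) /\ (good (flatten L) -> a_g g L = a_g g L').
  exact: h.
elim: LL' {gL} => {L L'} [D D' /(a_g_move g HBQ)|D|D D' _ [h1 h2]|D1 D2 D3 _ [h1 h2] _ [h3 h4]] //.
  by split=> [|gD]; [tauto | rewrite h2 //; apply/h1].
by split=> [|gD]; [tauto | rewrite h2 // h4 //; apply/h1].
Qed.
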